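(* Let $(M,\mathcal X)\models\mathsf{GB}$ and let $\Gamma\in\mathcal X$ be a class well-order (in $(M,\mathcal X)$) with $\Gamma\ge\omega^\omega$. Suppose $(M,\mathcal X)\models\mathsf{ETR}_{\Gamma\cdot\omega}$. Then there is $\mathcal Y\subseteq\mathcal X$ coded in $\mathcal X$ (i.e. there is $C\in\mathcal X$ with $\mathcal Y=\{(C)_i: i\in M\}$, where $(C)_i=\{y:(i,y)\in C\}$) such that $(M,\mathcal Y)\models\mathsf{GB}+\mathsf{ETR}_\Gamma$ but $(M,\mathcal Y)\not\models\mathsf{ETR}_{\Gamma\cdot\omega}$. If moreover $(M,\mathcal X)$ satisfies Global Choice, then $\mathcal Y$ can be chosen so that $(M,\mathcal Y)$ also satisfies Global Choice.
   Context: Models of second-order set theory are pairs $(M,\mathcal X)$ with $\mathcal X\subseteq\mathcal P(M)$. $\mathsf{GB}$ consists of $\mathsf{ZF}$, Extensionality for classes, Class Replacement, Elementary Comprehension (comprehension for formulas without class quantifiers, with set and class parameters). Global Choice: there is a class bijection between $V$ and $\mathrm{Ord}$. For a class well-order $\Delta$, $\mathsf{ETR}_\Delta$ is the schema: for every first-order $\varphi(x,Y,A)$ (class parameter $A$) and every well-founded class relation $R$ of rank $\le\Delta$, there is a class $S\subseteq\mathrm{dom}R\times V$ with $S_r=\{x:\varphi(x,S\restriction r,A)\}$ for all $r\in\mathrm{dom}R$, where $S_r=\{x:(r,x)\in S\}$, $S\restriction r=S\cap(\{r':r'<_Rr\}\times V)$, $<_R$ the transitive closure of $R$. $\Gamma\cdot\omega$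 is the ordinal product (lexicographic order on $\omega\times\Gamma$), and $\Gamma\ge\omega^\omega$ means $\omega^\omega$ embeds as an initial segment of $\Gamma$. *)

(* Defs.v *)
From mathcomp Require Import all_boot boolp classical_sets.

Set Implicit Arguments.
Unset Strict Implicit.
Unset Printing Implicit Defensive.

Local Open Scope classical_set_scope.

(** First-order formulas of the language of classes: no class quantifiers, [n]
    free set variables (de Bruijn indices) and [m] free class variables.
    [formula 0 n] is thus the set of formulas of the language of set theory. *)
Inductive formula (m : nat) : nat -> Type :=
| FMem  n of 'I_n & 'I_n : formula m n
| FEq   n of 'I_n & 'I_n : formula m n
| FIn   n of 'I_n & 'I_m : formula m n
| FBot  n : formula m n
| FImp  n of formula m n & formula m n : formula m n
| FAll  n of formula m n.+1 : formula m n.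

Record structure := Structure {
  carrier :> Type;
  mem_of : carrier -> carrier -> Prop }.

Notation "x ∈ y" := (mem_of x y) (at level 70, no associativity).

Definition fcons (T : Type) (n : nat) (x : T) (s : 'I_n -> T) : 'I_n.+1 -> T :=
  fun i => if unlift ord0 i is Some j then s j else x.

Fixpoint sat (M : structure) (m : nat) (A : 'I_m -> set M) (n : nat)
    (phi : formula m n) : ('I_n -> M) -> Prop :=
  match phi in formula _ n return ('I_n -> M) -> Prop with
  | FMem _ i j => fun s => s i ∈ s j
  | FEq _ i j => fun s => s i = s j
  | FIn _ i k => fun s => A k (s i)
  | FBot _ => fun _ => False
  | FImp _ phi psi => fun s => sat A phi s -> sat A psi s
  | FAll _ phi => fun s => forall x : M, sat A phi (fcons x s)
  end.

(** * Set-theoretic notions, interpreted in a structure [M]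

    [M] may be ill-founded, even omega-nonstandard: naturals, pairs, ordinals
    and finite sequences below are those of [M]. *)

Definition ext (M : structure) (a : M) : set M := [set x | x ∈ a].

Definition is_zero (M : structure) (z : M) : Prop := forall x : M, ~ x ∈ z.

Definition is_succ (M : structure) (y x : M) : Prop :=
  forall z : M, z ∈ y <-> (z ∈ x \/ z = x).

Definition inductive (M : structure) (I : M) : Prop :=
  (exists z : M, is_zero z /\ z ∈ I) /\
  (forall x : M, x ∈ I -> exists y : M, is_succ y x /\ y ∈ I).

Definition omega (M : structure) : set M :=
  [set n | forall I : M, inductive I -> n ∈ I].

Arguments omega : clear implicits.

(** Linearity of the membership relation suffices, as Foundation is always
    assumed. *)
Definition ordinals (M : structure) : set M :=
  [set a | (forall x y : M, y ∈ x -> x ∈ a -> y ∈ a) /\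
           (forall x y : M, x ∈ a -> y ∈ a -> x ∈ y \/ x = y \/ y ∈ x)].

Arguments ordinals : clear implicits.

Definition is_upair (M : structure) (z x y : M) : Prop :=
  forall w : M, w ∈ z <-> (w = x \/ w = y).

(** Kuratowski pairs *)
Definition is_pair (M : structure) (p x y : M) : Prop :=
  forall z : M, z ∈ p <-> (is_upair z x x \/ is_upair z x y).

Definition related (M : structure) (R : set M) (x y : M) : Prop :=
  exists p : M, is_pair p x y /\ R p.

Definition is_relation (M : structure) (R : set M) : Prop :=
  forall p : M, R p -> exists x y : M, is_pair p x y.

(** The domain of a relation in the sense of the objects it relates, on either
    side. *)
Definition dom (M : structure) (R : set M) : set M :=
  [set x | exists y : M, related R x y \/ related R y x].

(** [F] is a function from [D] to [B]. *)
Definition is_function (M : structure) (F D B : set M) : Prop :=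
  (forall p : M, F p -> exists x y : M, [/\ is_pair p x y, D x & B y]) /\
  (forall x : M, D x -> exists! y : M, related F x y).

Definition slice (M : structure) (C : set M) (i : M) : set M :=
  [set y | related C i y].

(** * GB *)

Definition Separation (M : structure) : Prop :=
  forall (n : nat) (phi : formula 0 n.+1) (s : 'I_n -> M) (a : M),
  exists b : M, forall x : M,
    x ∈ b <-> (x ∈ a /\ sat (fun=> set0) phi (fcons x s)).

Definition Replacement (M : structure) : Prop :=
  forall (n : nat) (phi : formula 0 n.+2) (s : 'I_n -> M) (a : M),
  let P x y := sat (fun=> set0) phi (fcons x (fcons y s)) in
  (forall x y y' : M, x ∈ a -> P x y -> P x y' -> y = y') ->
  exists b : M, forall y : M, y ∈ b <-> (exists x : M, x ∈ a /\ P x y).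

Record ZF (M : structure) : Prop := {
  ZF_extensionality : forall a b : M,
    (forall x : M, x ∈ a <-> x ∈ b) -> a = b;
  ZF_foundation : forall a : M, (exists x : M, x ∈ a) ->
    exists x : M, x ∈ a /\ (forall y : M, y ∈ a -> ~ y ∈ x);
  ZF_pairing : forall a b : M, exists c : M, is_upair c a b;
  ZF_union : forall a : M, exists b : M, forall x : M,
    x ∈ b <-> (exists y : M, x ∈ y /\ y ∈ a);
  ZF_powerset : forall a : M, exists b : M, forall x : M,
    x ∈ b <-> (forall y : M, y ∈ x -> y ∈ a);
  ZF_infinity : exists I : M, inductive I;
  ZF_separation : Separation M;
  ZF_replacement : Replacement M }.

Definition ClassReplacement (M : structure) (X : set (set M)) : Prop :=
  forall (F : set M) (a : M), X F -> is_relation F ->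
  (forall x y y' : M, related F x y -> related F x y' -> y = y') ->
  exists b : M, forall y : M, y ∈ b <-> (exists x : M, x ∈ a /\ related F x y).

Definition ElementaryComprehension (M : structure) (X : set (set M)) : Prop :=
  forall (m n : nat) (phi : formula m n.+1) (A : 'I_m -> set M)
         (s : 'I_n -> M),
  (forall k : 'I_m, X (A k)) -> X [set x | sat A phi (fcons x s)].

(** Extensionality for classes holds by construction: classes are subsets
    of [M]. *)
Record GB (M : structure) (X : set (set M)) : Prop := {
  GB_ZF : ZF M;
  GB_replacement : ClassReplacement X;
  GB_comprehension : ElementaryComprehension X }.

Definition GlobalChoice (M : structure) (X : set (set M)) : Prop :=
  exists F : set M,
    [/\ X F, is_function F [set: M] (ordinals M) &
        forall a : M, ordinals M a -> exists! x : M, related F x a].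

(** * Well-founded relations, well-orders and their ranks *)

Definition well_founded_class (M : structure) (X : set (set M)) (R : set M)
    : Prop :=
  is_relation R /\
  forall D : set M, X D -> D !=set0 ->
    exists x : M, D x /\ forall y : M, D y -> ~ related R y x.

(** Well-orders are strict. *)
Definition class_well_order (M : structure) (X : set (set M)) (L : set M)
    : Prop :=
  [/\ well_founded_class X L,
      forall x y z : M, related L x y -> related L y z -> related L x z &
      forall x y : M, dom L x -> dom L y ->
        related L x y \/ x = y \/ related L y x].

(** [F] is the rank function of [R], with ranks measured along the well-order
    [L]: [F x] is the least element of [L] above all [F y], [y R x]. *)
Definition is_rank_function (M : structure) (F R L : set M) : Prop :=
  is_function F (dom R) (dom L) /\
  forall x d : M, related F x d ->
    let above c := forall y e : M, related R y x -> related F y e ->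
                   related L e c in
    above d /\ (forall c : M, dom L c -> above c -> d = c \/ related L d c).

Definition rank_le (M : structure) (X : set (set M)) (R L : set M) : Prop :=
  exists F : set M, X F /\ is_rank_function F R L.

(** Transitive closure of [R] in the sense of [M]: [f] is a sequence of length
    [n + 1], [n <> 0], from [x] to [y]. *)
Definition trans_closure (M : structure) (R : set M) (x y : M) : Prop :=
  exists n n' f : M,
    [/\ omega M n, ~ is_zero n, is_succ n' n &
        is_function (ext f) (ext n') [set: M]] /\
    [/\ exists z : M, is_zero z /\ related (ext f) z x,
        related (ext f) n y &
        forall k k' u v : M, k ∈ n -> is_succ k' k ->
          related (ext f) k u -> related (ext f) k' v -> related R u v].

(** * Elementary transfinite recursion *)

Definition restr (M : structure) (S R : set M) (r : M) : set M :=
  [set p | S p /\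
           exists r' x : M, is_pair p r' x /\ trans_closure R r' r].

Definition ETR (M : structure) (X : set (set M)) (L : set M) : Prop :=
  forall (phi : formula 2 1) (A R : set M),
  X A -> X R -> well_founded_class X R -> rank_le X R L ->
  exists S : set M,
    [/\ X S,
        forall p : M, S p -> exists r x : M, is_pair p r x /\ dom R r &
        forall r : M, dom R r ->
          slice S r =
          [set x | sat (fun k : 'I_2 => if k == ord0 then restr S R r else A)
                       phi (fun=> x)]].

(** * Products by omega and the ordinal omega^omega *)

(** Lexicographic order on omega x D, where D is ordered by [lt]; the domain is
    given separately so that one-point orders are covered. *)
Definition lex_dom (M : structure) (D : set M) : set M :=
  [set u | exists n a : M, [/\ is_pair u n a, omega M n & D a]].

Definition lex_lt (M : structure) (D : set M) (lt : M -> M -> Prop) (u v : M)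
    : Prop :=
  exists n a m b : M,
    [/\ is_pair u n a, is_pair v m b, omega M n & omega M m] /\
    [/\ D a, D b & n ∈ m \/ (n = m /\ lt a b)].

Definition times_omega (M : structure) (L : set M) : set M :=
  [set p | exists u v : M, is_pair p u v /\ lex_lt (dom L) (related L) u v].

Definition order_embedding (M : structure) (F : set M)
    (D1 : set M) (lt1 : M -> M -> Prop) (D2 : set M) (lt2 : M -> M -> Prop)
    : Prop :=
  is_function F D1 D2 /\
  forall x x' y y' : M, related F x y -> related F x' y' ->
    (lt1 x x' <-> lt2 y y').

Definition order_iso (M : structure) (F : set M)
    (D1 : set M) (lt1 : M -> M -> Prop) (D2 : set M) (lt2 : M -> M -> Prop)
    : Prop :=
  order_embedding F D1 lt1 D2 lt2 /\
  forall y : M, D2 y -> exists x : M, related F x y.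

Definition initial_embedding (M : structure) (F : set M)
    (D1 : set M) (lt1 : M -> M -> Prop) (D2 : set M) (lt2 : M -> M -> Prop)
    : Prop :=
  order_embedding F D1 lt1 D2 lt2 /\
  forall x y y' : M, related F x y -> D2 y' -> lt2 y' y ->
    exists x' : M, related F x' y'.

(** The ordinal [b] is the product of the ordinal [a] by omega. *)
Definition is_ord_times_omega (M : structure) (b a : M) : Prop :=
  ordinals M b /\
  exists g : M, order_iso (ext g)
    (lex_dom (ext a)) (lex_lt (ext a) (@mem_of M)) (ext b) (@mem_of M).

(** omega^omega = sup_n f(n), with f(0) = 1 and f(n + 1) = f(n) * omega. *)
Definition is_omega_omega (M : structure) (a : M) : Prop :=
  exists f : M,
    [/\ is_function (ext f) (omega M) [set: M],
        forall z y : M, is_zero z -> related (ext f) z y -> is_succ y z,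
        forall n n' b c : M, omega M n -> is_succ n' n ->
          related (ext f) n b -> related (ext f) n' c ->
          is_ord_times_omega c b &
        forall x : M, x ∈ a <->
          (exists n b : M, related (ext f) n b /\ x ∈ b)].

Definition ge_omega_omega (M : structure) (X : set (set M)) (L : set M)
    : Prop :=
  exists a : M, is_omega_omega a /\
  exists F : set M, X F /\
    initial_embedding F (ext a) (@mem_of M) (dom L) (related L).

(** * Coded families of classes *)

Definition coded (M : structure) (X Y : set (set M)) : Prop :=
  exists C : set M, X C /\ Y = range (slice C).

(* Main.v *)
Require Import Defs.
From mathcomp Require Import all_boot boolp classical_sets.

(** ETR along [Gamma * omega] builds a hierarchy [S] of that length whose level
    [u] codes one more layer of first-order definability over the classes of the
    lower levels. The classes occurring in [S] form [Y]. A segment of the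
    hierarchy without last level is closed under elementary comprehension: a
    formula is a finite tree of layers.

    [Y] fails ETR along [Gamma * omega]: a solution in [Y] of the recursion
    defining [S] would be [S] itself, and [S] codes all of [Y], so one
    diagonalises.

    [Y] satisfies ETR along [Gamma]: let the recursion have its parameters below
    level [(n, 0)]. By induction on [d] in [Gamma], the solution up to rank [d]
    occurs below the first limit level after [(n, d)]. It is defined by one
    formula from the segment of the hierarchy in which the earlier partial
    solutions occur, where they are recognised as the classes that satisfy the
    recursion; so their indices need not be tracked. Of [Gamma >= omega^omega]
    one only uses that limit levels are cofinal. *)

Set Implicit Arguments.
Unset Strict Implicit.
Unset Printing Implicit Defensive.

Local Open Scope classical_set_scope.

(** * First-order definability *)

Definition scons (T : Type) (x : T) (e : nat -> T) : nat -> T :=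
  fun n => if n is n'.+1 then e n' else x.

(** Predicates on environments that are first-order over the classes in [Cs],
    uniformly in a world [w : W]; [n] bounds the free set variables. Working up
    to this semantic notion avoids manipulating formulas. *)
Inductive dfn (M : structure) (W : Type) (Cs : set (W -> set M)) :
    nat -> (W -> (nat -> M) -> Prop) -> Prop :=
| dfn_mem0 n i j : i < n -> j < n -> dfn Cs n (fun _ e => e i ∈ e j)
| dfn_eq0 n i j : i < n -> j < n -> dfn Cs n (fun _ e => e i = e j)
| dfn_cls0 n i C : i < n -> Cs C -> dfn Cs n (fun w e => C w (e i))
| dfn_const n (p : Prop) : dfn Cs n (fun _ _ => p)
| dfn_imp n P Q : dfn Cs n P -> dfn Cs n Q ->
    dfn Cs n (fun w e => P w e -> Q w e)
| dfn_all0 n P : dfn Cs n.+1 P ->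
    dfn Cs n (fun w e => forall x : M, P w (scons x e)).

Section Formulas.
Variable M : structure.

Fixpoint class_ren m m' (g : 'I_m -> 'I_m') n (phi : formula m n) :
    formula m' n :=
  match phi in formula _ n return formula m' n with
  | FMem _ i j => FMem m' i j
  | FEq _ i j => FEq m' i j
  | FIn _ i k => FIn i (g k)
  | FBot n => FBot m' n
  | FImp _ phi psi => FImp (class_ren g phi) (class_ren g psi)
  | FAll _ phi => FAll (class_ren g phi)
  end.

Lemma sat_class_ren m m' (g : 'I_m -> 'I_m') (A : 'I_m' -> set M) n
    (phi : formula m n) (s : 'I_n -> M) :
  sat A (class_ren g phi) s <-> sat (A \o g) phi s.
Proof.
elim: phi s => //= {}n.
- by move=> phi ihphi psi ihpsi s; rewrite ihphi ihpsi.
- by move=> phi ih s; split=> h x; apply/ih/h.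
Qed.

Lemma fcons_env n (x : M) (e : nat -> M) :
  fcons x (fun i : 'I_n => e i) = fun i : 'I_n.+1 => scons x e i.
Proof.
apply/funext => i; rewrite /fcons; case: unliftP => [j|] -> //=.
Qed.

(** Induction on the derivation: the class symbols of the two sides of an implication are
    concatenated, and a constant proposition becomes [FBot] or its negation. The quantifier order
    records the uniformity: [phi] is chosen before the world [w]. *)
Lemma dfn_formula (W : Type) (Cs : set (W -> set M)) n P : dfn Cs n P ->
  exists m (cl : 'I_m -> W -> set M) (phi : formula m n),
    (forall k, Cs (cl k)) /\
    forall w e, P w e <-> sat (fun k => cl k w) phi (fun i => e i).
Proof.
elim=> {P} {}n.
- move=> i j hi hj; have f : 'I_0 -> W -> set M by case.
  by exists 0, f, (FMem 0 (Ordinal hi) (Ordinal hj)); split=> //; case.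
- move=> i j hi hj; have f : 'I_0 -> W -> set M by case.
  by exists 0, f, (FEq 0 (Ordinal hi) (Ordinal hj)); split=> //; case.
- move=> i C hi hC.
  by exists 1, (fun=> C), (FIn (Ordinal hi) ord0); split.
- move=> p; have f : 'I_0 -> W -> set M by case.
  exists 0, f; have [hp|hp] := pselect p.
    by exists (FImp (FBot 0 n) (FBot 0 n)); split=> [[]//|w e /=]; split.
  by exists (FBot 0 n); split=> [[]//|w e /=]; split.
- move=> P Q _ [m [cl [phi [hcl hphi]]]] _ [m' [cl' [phi' [hcl' hphi']]]].
  exists (m + m'), (fun k => match split k with inl k => cl k | inr k => cl' k end),
    (FImp (class_ren (lshift m') phi) (class_ren (@rshift m m') phi')); split.
    by move=> k; case: (split k).
  move=> w e /=; rewrite !sat_class_ren hphi hphi'.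
  have -> : (fun k => match split k with
    inl k0 => cl k0 | inr k0 => cl' k0 end w) \o lshift m' = cl^~ w.
    by apply/funext => k /=; rewrite (unsplitK (inl k)).
  have -> // : (fun k => match split k with
    inl k0 => cl k0 | inr k0 => cl' k0 end w) \o @rshift m m' = cl'^~ w.
  by apply/funext => k /=; rewrite (unsplitK (inr k)).
- move=> P _ [m [cl [phi [hcl hphi]]]]; exists m, cl, (FAll phi); split=> //.
  move=> w e /=; split=> h x; first by rewrite fcons_env -hphi.
  by rewrite hphi -fcons_env.
Qed.

Lemma EC_dfn (K : set (set M)) (P : set M) : ElementaryComprehension K ->
  dfn (fun c : unit -> set M => K (c tt)) 1 (fun _ e => P (e 0)) -> K P.
Proof.
move=> hK /dfn_formula[m [cl [phi [hcl hphi]]]].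
have s : 'I_0 -> M by case.
have -> : P = [set x | sat (cl^~ tt) phi (fcons x s)].
  apply/predeqP => x /=; have /= -> := hphi tt (fun=> x).
  have -> // : fcons x s = (fun=> x).
  by apply/funext => i; rewrite /fcons; case: unliftP => // -[].
exact: hK.
Qed.

(** Worlds are pairs [(T, A)], so one formula serves all [T] and [A], as [ETR] demands. The map [g]
    merges the symbols delivered by [dfn_formula] into two class variables. *)
Lemma formula_of_dfn2 (P : set M -> set M -> set M) :
  dfn (W := set M * set M) [set c | c = fst \/ c = snd] 1
    (fun w e => P w.1 w.2 (e 0)) ->
  exists phi : formula 2 1, forall T A x,
    P T A x <-> sat (fun k : 'I_2 => if k == ord0 then T else A) phi (fun=> x).
Proof.
move=> /dfn_formula[m [cl [phi [hcl hphi]]]].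
pose g (k : 'I_m) : 'I_2 := if pselect (cl k = fst) then ord0 else ord_max.
exists (class_ren g phi) => T A x; rewrite sat_class_ren.
have /= -> := hphi (T, A) (fun=> x).
suff -> : cl^~ (T, A) = (fun k : 'I_2 => if k == ord0 then T else A) \o g by [].
apply/funext => k /=; rewrite /g; case: pselect => [h|h] /=; first by rewrite h.
by case: (hcl k) => // ->.
Qed.

(** * Closure properties of definable predicates *)

Section Closure.
Variables (W : Type) (Cs : set (W -> set M)).
Local Notation dfn := (dfn Cs).

Lemma dfn_ext n P Q : dfn n P -> (forall w e, Q w e <-> P w e) -> dfn n Q.
Proof. by move=> hP h; have -> : Q = P by apply/funext=> w; apply/predeqP. Qed.

Lemma dfn_all n (Q : W -> (nat -> M) -> M -> Prop) :
  dfn n.+1 (fun w e => Q w (fun i => e i.+1) (e 0)) ->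
  dfn n (fun w e => forall x, Q w e x).
Proof. by move/dfn_all0. Qed.

Lemma dfn_not n P : dfn n P -> dfn n (fun w e => ~ P w e).
Proof. by move=> h; apply: dfn_imp h (dfn_const _ _ False). Qed.

Lemma dfn_or n P Q : dfn n P -> dfn n Q -> dfn n (fun w e => P w e \/ Q w e).
Proof.
move=> hP hQ; apply: dfn_ext (dfn_imp (dfn_not hP) hQ) _ => w e.
by split=> [[]//|h]; have [|/h] := pselect (P w e); [left|right].
Qed.

Lemma dfn_and n P Q : dfn n P -> dfn n Q -> dfn n (fun w e => P w e /\ Q w e).
Proof.
move=> hP hQ; apply: dfn_ext (dfn_not (dfn_imp hP (dfn_not hQ))) _ => w e.
by split=> [[hp hq] /(_ hp hq)//|h]; split; apply: contrapT => h'; apply: h.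
Qed.

Lemma dfn_and3 n P Q R : dfn n P -> dfn n Q -> dfn n R ->
  dfn n (fun w e => [/\ P w e, Q w e & R w e]).
Proof.
move=> hP hQ hR; apply: dfn_ext (dfn_and hP (dfn_and hQ hR)) _ => w e.
by split=> [[]|[? []]].
Qed.

Lemma dfn_and4 n P Q R S : dfn n P -> dfn n Q -> dfn n R -> dfn n S ->
  dfn n (fun w e => [/\ P w e, Q w e, R w e & S w e]).
Proof.
move=> hP hQ hR hS; apply: dfn_ext (dfn_and hP (dfn_and3 hQ hR hS)) _ => w e.
by split=> [[]|[? []]].
Qed.

Lemma dfn_iff n P Q : dfn n P -> dfn n Q -> dfn n (fun w e => P w e <-> Q w e).
Proof. by move=> hP hQ; apply: dfn_and; apply: dfn_imp. Qed.

Lemma dfn_ex n (Q : W -> (nat -> M) -> M -> Prop) :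
  dfn n.+1 (fun w e => Q w (fun i => e i.+1) (e 0)) ->
  dfn n (fun w e => exists x, Q w e x).
Proof.
move=> /dfn_not/(@dfn_all n (fun w e x => ~ Q w e x))/dfn_not hQ.
by apply: dfn_ext hQ _ => w e; rewrite -existsNE; split; move=> [x hx]; exists x;
  [rewrite not_notE|apply: contrapT].
Qed.

Lemma dfn_ren n P : dfn n P -> forall n' (r : nat -> nat),
  (forall i, i < n -> r i < n') -> dfn n' (fun w e => P w (fun i => e (r i))).
Proof.
elim=> {P} {}n.
- by move=> i j hi hj n' r hr; apply: dfn_mem0; apply: hr.
- by move=> i j hi hj n' r hr; apply: dfn_eq0; apply: hr.
- by move=> i C hi hC n' r hr; apply: dfn_cls0 => //; apply: hr.
- by move=> p n' r _; apply: dfn_const.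
- by move=> P Q _ ihP _ ihQ n' r hr; apply: dfn_imp; [apply: ihP|apply: ihQ].
- move=> P _ ih n' r hr.
  apply: (@dfn_all n' (fun w e x => P w (scons x (fun i => e (r i))))).
  pose r' i := if i is i'.+1 then (r i').+1 else 0.
  apply: dfn_ext (ih n'.+1 r' _) _; first by case.
  by move=> w e; have -> : scons (e 0) (fun i => e (r i).+1) =
    fun i => e (r' i) by apply/funext; case.
Qed.

(** A term is handled through its graph, with its value in variable 0. *)
Definition tdf n (t : W -> (nat -> M) -> M) : Prop :=
  dfn n.+1 (fun w e => e 0 = t w (fun i => e i.+1)).

Lemma tdf_ren n t : tdf n t -> forall n' (r : nat -> nat),
  (forall i, i < n -> r i < n') -> tdf n' (fun w e => t w (fun i => e (r i))).
Proof.
move=> h n' r hr; pose r' i := if i is i'.+1 then (r i').+1 else 0.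
by have := dfn_ren h (n' := n'.+1) (r := r'); apply; case.
Qed.

Lemma tdfS n t : tdf n t -> tdf n.+1 (fun w e => t w (fun i => e i.+1)).
Proof. by move=> h; apply: (tdf_ren h (r := succn)). Qed.

Lemma tdf_var n i : i < n -> tdf n (fun _ e => e i).
Proof. by move=> hi; apply: dfn_eq0. Qed.

(** Set parameters enter as singleton classes, so that environments only hold variables. *)
Lemma tdf_const n c : Cs (fun=> [set c]) -> tdf n (fun _ _ => c).
Proof. by move=> hc; apply: (@dfn_cls0 _ _ _ _ 0 (fun=> [set c])). Qed.

(** A term is eliminated by an existential quantifier over its value. *)
Lemma dfn_term n t (Q : W -> (nat -> M) -> M -> Prop) : tdf n t ->
  dfn n.+1 (fun w e => Q w (fun i => e i.+1) (e 0)) ->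
  dfn n (fun w e => Q w e (t w e)).
Proof.
move=> ht hQ.
have h := @dfn_ex n (fun w e x => x = t w e /\ Q w e x) (dfn_and ht hQ).
by apply: dfn_ext h _ => w e; split=> [?|[x [->]]//]; exists (t w e).
Qed.

Lemma dfn_eq n t t' : tdf n t -> tdf n t' -> dfn n (fun w e => t w e = t' w e).
Proof.
move=> ht ht'; apply: (@dfn_term n t (fun w e x => x = t' w e)) => //.
Qed.

Lemma dfn_mem n t t' : tdf n t -> tdf n t' -> dfn n (fun w e => t w e ∈ t' w e).
Proof.
move=> ht ht'; apply: (@dfn_term n t (fun w e x => x ∈ t' w e)) => //.
apply: (@dfn_term n.+1 _ (fun w e x => e 0 ∈ x)); first exact: tdfS.
exact: dfn_mem0.
Qed.

Lemma dfn_cls n C t : Cs C -> tdf n t -> dfn n (fun w e => C w (t w e)).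
Proof.
by move=> hC ht; apply: (@dfn_term n t (fun w e x => C w x)) => //;
  apply: dfn_cls0.
Qed.

Lemma dfn_upair n t t' t'' : tdf n t -> tdf n t' -> tdf n t'' ->
  dfn n (fun w e => is_upair (t w e) (t' w e) (t'' w e)).
Proof.
move=> h h' h''.
apply: (@dfn_all _ (fun w e x => x ∈ t w e <-> x = t' w e \/ x = t'' w e)).
apply: dfn_iff.
  by apply: (dfn_mem (t := fun _ e => e 0)); [apply: tdf_var|apply: tdfS].
by apply: dfn_or; apply: (dfn_eq (t := fun _ e => e 0)); try exact: tdf_var;
  exact: tdfS.
Qed.

Lemma dfn_pair n t t' t'' : tdf n t -> tdf n t' -> tdf n t'' ->
  dfn n (fun w e => is_pair (t w e) (t' w e) (t'' w e)).
Proof.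
move=> h h' h''.
apply: (@dfn_all _ (fun w e x => x ∈ t w e <->
  is_upair x (t' w e) (t' w e) \/ is_upair x (t' w e) (t'' w e))).
apply: dfn_iff.
  by apply: (dfn_mem (t := fun _ e => e 0)); [apply: tdf_var|apply: tdfS].
by apply: dfn_or; apply: (dfn_upair (t := fun _ e => e 0)); try exact: tdf_var;
  exact: tdfS.
Qed.

(** Substitution of definable classes for the class variables of a formula. The renamings [r] and
    [v] keep the induction going under a quantifier, which shifts both the parameters of the classes
    and the variables of [phi]. *)
Lemma dfn_sat q m n (phi : formula m n) (C : 'I_m -> W -> (nat -> M) -> set M) :
  (forall k, dfn q.+1 (fun w e => C k w (fun i => e i.+1) (e 0))) ->
  forall N (r : nat -> nat) (v : 'I_n -> nat),
  (forall i, i < q -> r i < N) -> (forall i, v i < N) ->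
  dfn N (fun w e => sat (fun k => C k w (fun i => e (r i))) phi
                        (fun i => e (v i))).
Proof.
move=> hC; elim: phi => {}n /=.
- by move=> i j N r v hr hv; apply: dfn_mem0.
- by move=> i j N r v hr hv; apply: dfn_eq0.
- move=> i k N r v hr hv.
  (* Variable 0 in the definition of [C k] is the element tested for membership, here variable
     [v i]. *)
  pose r' x := if x is x'.+1 then r x' else v i.
  have hr' x : x < q.+1 -> r' x < N by case: x => [_|x]; [apply: hv|apply: hr].
  exact: (dfn_ren (hC k) hr').
- by move=> N r v hr hv; apply: dfn_const.
- by move=> phi ihphi psi ihpsi N r v hr hv; apply: dfn_imp;
    [apply: ihphi|apply: ihpsi].
- move=> phi ih N r v hr hv.
  apply: (@dfn_all N (fun w e x => sat (fun k => C k w (fun i => e (r i))) phi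
    (fcons x (fun i => e (v i))))).
  pose v' i := if unlift ord0 i is Some j then (v j).+1 else 0.
  have hv' i : v' i < N.+1.
    by rewrite /v'; case: unliftP => //= j _; apply: (hv j).
  apply: dfn_ext (ih N.+1 (succn \o r) v' hr hv') _.
  move=> w e; have -> // : fcons (e 0) (fun i => e (v i).+1) = fun i => e (v' i).
    by apply/funext => i; rewrite /fcons /v'; case: unliftP.
Qed.

Lemma dfn_sat21 N (phi : formula 2 1) (C : W -> (nat -> M) -> set M) A i :
  i < N -> Cs A -> dfn N.+1 (fun w e => C w (fun i => e i.+1) (e 0)) ->
  dfn N (fun w e => sat (fun k : 'I_2 => if k == ord0 then C w e else A w) phi
                        (fun=> e i)).
Proof.
move=> hi hA hC.
have := @dfn_sat N 2 1 phi (fun k w e => if k == ord0 then C w e else A w) _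
  N id (fun=> i); apply => // k.
by case: eqP => _ //; apply: dfn_cls0.
Qed.

End Closure.
End Formulas.

(** * Sets and natural numbers in a model *)

Section Sets.
Variables (M : structure) (hZF : ZF M).

Lemma set_ext (a b : M) : (forall x, x ∈ a <-> x ∈ b) -> a = b.
Proof. exact: ZF_extensionality. Qed.

Definition upair (x y : M) : M := projT1 (cid (ZF_pairing hZF x y)).
Definition pr (x y : M) : M := upair (upair x x) (upair x y).

Lemma mem_upair w x y : w ∈ upair x y <-> w = x \/ w = y.
Proof. by rewrite /upair; case: cid => z /= ->. Qed.

Lemma is_upairE z x y : is_upair z x y <-> z = upair x y.
Proof.
split=> [h|-> w]; last exact: mem_upair.
by apply: set_ext => w; rewrite mem_upair h.
Qed.

Lemma mem_pr z x y : z ∈ pr x y <-> z = upair x x \/ z = upair x y.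
Proof. exact: mem_upair. Qed.

Lemma is_pairE p x y : is_pair p x y <-> p = pr x y.
Proof.
split=> [h|-> z]; last by rewrite mem_pr !is_upairE.
by apply: set_ext => w; rewrite mem_pr h !is_upairE.
Qed.

Lemma upair_inj1 x y y' : upair x y = upair x y' -> y = y'.
Proof.
move=> h; have : y ∈ upair x y' by rewrite -h mem_upair; right.
rewrite mem_upair => -[yx|//].
have : y' ∈ upair x y by rewrite h mem_upair; right.
by rewrite mem_upair yx => -[].
Qed.

Lemma pr_inj x y x' y' : pr x y = pr x' y' -> x = x' /\ y = y'.
Proof.
move=> h; have xx' : x = x'.
  have : upair x x ∈ pr x' y' by rewrite -h mem_pr; left.
  have hx : x' ∈ upair x' x' by rewrite mem_upair; left.
  have hx' : x' ∈ upair x' y' by rewrite mem_upair; left.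
  by rewrite mem_pr => -[hu|hu]; [move: hx|move: hx']; rewrite -hu mem_upair;
    case.
by subst x'; split=> //; move/upair_inj1/upair_inj1: h.
Qed.

Lemma relE (R : set M) x y : related R x y <-> R (pr x y).
Proof.
split=> [[p [/is_pairE ->]]//|h]; exists (pr x y); split=> //.
exact/is_pairE.
Qed.

Lemma sliceE (R : set M) i y : slice R i y <-> R (pr i y).
Proof. exact: relE. Qed.

Lemma exists_zero : exists z : M, is_zero z.
Proof. by have [I [[z [hz _]] _]] := ZF_infinity hZF; exists z. Qed.

Definition zeroM : M := projT1 (cid exists_zero).

Lemma mem_zero x : ~ x ∈ zeroM.
Proof. by rewrite /zeroM; case: cid. Qed.

Lemma is_zeroE z : is_zero z <-> z = zeroM.
Proof.
split=> [h|-> x]; last exact: mem_zero.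
by apply: set_ext => x; split=> [/h//|/mem_zero].
Qed.

Lemma exists_union2 (a b : M) : exists c, forall x, x ∈ c <-> x ∈ a \/ x ∈ b.
Proof.
have [c hc] := ZF_union hZF (upair a b); exists c => x; rewrite hc.
split=> [[y []]|[h|h]].
- by move=> h; rewrite mem_upair => -[<-|<-]; [left|right].
- by exists a; rewrite mem_upair; split=> //; left.
- by exists b; rewrite mem_upair; split=> //; right.
Qed.

Lemma exists_suc (x : M) : exists y, is_succ y x.
Proof.
have [y hy] := exists_union2 x (upair x x); exists y => z; rewrite hy mem_upair.
by split=> [[|[]]|[]]; tauto.
Qed.

Definition suc (x : M) : M := projT1 (cid (exists_suc x)).

Lemma mem_suc z x : z ∈ suc x <-> z ∈ x \/ z = x.
Proof. by rewrite /suc; case: cid => y /= ->. Qed.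

Lemma is_succE y x : is_succ y x <-> y = suc x.
Proof.
split=> [h|-> z]; last exact: mem_suc.
by apply: set_ext => z; rewrite mem_suc h.
Qed.

Lemma suc_neq0 x : suc x <> zeroM.
Proof. by move=> h; apply: (@mem_zero x); rewrite -h mem_suc; right. Qed.

(** Zermelo numerals, for standard numbers only: they serve as tags for operations and as names of
    variables. *)
Fixpoint tg (n : nat) : M := if n is n'.+1 then upair (tg n') (tg n') else zeroM.

Lemma tg_inj n m : tg n = tg m -> n = m.
Proof.
have h k : upair (tg k) (tg k) <> zeroM.
  by move=> hk; apply: (@mem_zero (tg k)); rewrite -hk mem_upair; left.
elim: n m => [|n ih] [|m] //=; first by move/esym/h.
  by move/h.
move=> e; congr S; apply: ih; have : tg n ∈ upair (tg m) (tg m).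
  by rewrite -e mem_upair; left.
by rewrite mem_upair => -[].
Qed.

Section Terms.
Variables (W : Type) (Cs : set (W -> set M)).

Lemma tdf_upair n t t' : tdf Cs n t -> tdf Cs n t' ->
  tdf Cs n (fun w e => upair (t w e) (t' w e)).
Proof.
move=> h h'; apply: dfn_ext (dfn_upair (t := fun _ e => e 0) _ (tdfS h) (tdfS h')) _.
  exact: tdf_var.
by move=> w e /=; rewrite is_upairE.
Qed.

Lemma tdf_pr n t t' : tdf Cs n t -> tdf Cs n t' ->
  tdf Cs n (fun w e => pr (t w e) (t' w e)).
Proof. by move=> h h'; apply: tdf_upair; apply: tdf_upair. Qed.

Lemma tdf_zero n : tdf Cs n (fun _ _ => zeroM).
Proof.
have h : dfn Cs n.+1 (fun _ e => forall x, ~ x ∈ e 0).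
  by apply: dfn_all; apply: dfn_not; apply: dfn_mem0.
by apply: dfn_ext h _ => w e /=; rewrite -is_zeroE.
Qed.

Lemma tdf_suc n t : tdf Cs n t -> tdf Cs n (fun w e => suc (t w e)).
Proof.
move=> h; have h' : dfn Cs n.+1 (fun w e => forall x, x ∈ e 0 <->
    x ∈ t w (fun i => e i.+1) \/ x = t w (fun i => e i.+1)).
  apply: (@dfn_all _ _ _ _ (fun w e x => x ∈ e 0 <->
    x ∈ t w (fun i => e i.+1) \/ x = t w (fun i => e i.+1))).
  apply: dfn_iff; first exact: dfn_mem0.
  apply: dfn_or; first apply: (dfn_mem (t := fun _ e => e 0)).
  - exact: tdf_var.
  - by have := tdfS (tdfS h).
  - by apply: (dfn_eq (t := fun _ e => e 0)); [apply: tdf_var|exact: tdfS (tdfS h)].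
by apply: dfn_ext h' _ => w e /=; rewrite -is_succE.
Qed.

Lemma tdf_tg n k : tdf Cs n (fun _ _ => tg k).
Proof. by elim: k => [|k ih] /=; [apply: tdf_zero|apply: tdf_upair]. Qed.

Lemma dfn_related n C t t' : Cs C -> tdf Cs n t -> tdf Cs n t' ->
  dfn Cs n (fun w e => related (C w) (t w e) (t' w e)).
Proof.
move=> hC h h'; apply: dfn_ext (dfn_cls hC (tdf_pr h h')) _ => w e.
exact: relE.
Qed.

End Terms.

Lemma EC_set1 (K : set (set M)) c : ElementaryComprehension K -> K [set c].
Proof.
move=> hK; have A : 'I_0 -> set M by case.
have := hK 0 1 (FEq 0 ord0 ord_max) A (fun=> c) => /=.
set B := [set _ | _]; have -> : B = [set c]; last by apply; case.
by rewrite /B; apply/predeqP => x /=; rewrite /fcons unlift_none;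
  case: unliftP => //= j _.
Qed.

End Sets.

(** * Tactics for definability *)

Ltac tdf_solve :=
  cbv beta;
  lazymatch goal with
  | |- tdf _ _ (fun _ e => e ?i) => apply: tdf_var; done
  | |- tdf _ _ (fun w e => pr _ (@?t w e) (@?t' w e)) =>
      apply: tdf_pr; tdf_solve
  | |- tdf _ _ (fun w e => upair _ (@?t w e) (@?t' w e)) =>
      apply: tdf_upair; tdf_solve
  | |- tdf _ _ (fun w e => suc _ (@?t w e)) => apply: tdf_suc; tdf_solve
  | |- tdf _ _ (fun _ _ => zeroM _) => apply: tdf_zero
  | |- tdf _ _ (fun _ _ => tg _ _) => apply: tdf_tg
  | |- tdf _ _ (fun _ _ => ?c) => apply: tdf_const; apply: EC_set1; eassumption
  end.

(** Atoms built with [sat] or [trans_closure] are left open, to be closed by [dfn_sat21] and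
    [dfn_tc]. *)
Ltac dfn_solve :=
  cbv beta;
  lazymatch goal with
  | |- dfn _ _ (fun _ _ => ?p) => apply: dfn_const
  | |- dfn _ _ (fun w e => @?P w e /\ @?Q w e) => apply: dfn_and; dfn_solve
  | |- dfn _ _ (fun w e => and3 (@?P w e) (@?Q w e) (@?R w e)) =>
      apply: dfn_and3; dfn_solve
  | |- dfn _ _ (fun w e => and4 (@?P w e) (@?Q w e) (@?R w e) (@?S w e)) =>
      apply: dfn_and4; dfn_solve
  | |- dfn _ _ (fun w e => @?P w e \/ @?Q w e) => apply: dfn_or; dfn_solve
  | |- dfn _ _ (fun w e => ~ @?P w e) => apply: dfn_not; dfn_solve
  | |- dfn _ _ (fun w e => @?P w e <-> @?Q w e) => apply: dfn_iff; dfn_solve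
  | |- dfn _ _ (fun w e => @?P w e -> @?Q w e) => apply: dfn_imp; dfn_solve
  | |- dfn _ _ (fun w e => forall x : _, @?Q w e x) =>
      apply: (dfn_all (Q := Q)); dfn_solve
  | |- dfn _ _ (fun w e => exists x : _, @?Q w e x) =>
      apply: (dfn_ex (Q := Q)); dfn_solve
  | |- dfn _ _ (fun w e => mem_of (@?t w e) (@?t' w e)) =>
      apply: dfn_mem; tdf_solve
  | |- dfn _ _ (fun w e => @?t w e = @?t' w e) => apply: dfn_eq; tdf_solve
  | |- dfn _ _ (fun w e => is_pair (@?t w e) (@?t' w e) (@?t'' w e)) =>
      apply: dfn_pair; tdf_solve
  | |- dfn _ _ (fun w e => related ?C (@?t w e) (@?t' w e)) =>
      apply: (@dfn_related _ ltac:(eassumption) _ _ _ (fun=> C));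
      [eassumption|tdf_solve|tdf_solve]
  | |- dfn _ _ (fun w e => sat (@?B w e) ?phi (@?s w e)) => idtac
  | |- dfn _ _ (fun w e => trans_closure ?R (@?t w e) (@?t' w e)) => idtac
  | |- dfn _ _ (fun w e => fst w (@?t w e)) =>
      apply: (@dfn_cls _ _ _ _ fst); [by left|tdf_solve]
  | |- dfn _ _ (fun w e => snd w (@?t w e)) =>
      apply: (@dfn_cls _ _ _ _ snd); [by right|tdf_solve]
  | |- dfn _ _ (fun w e => ?C (@?t w e)) =>
      apply: (@dfn_cls _ _ _ _ (fun=> C)); [eassumption|tdf_solve]
  | _ => idtac
  end.

Ltac EC_solve := (apply: EC_dfn; first by eassumption); rewrite /mkset; dfn_solve.

(** * Separation, induction and transitive closure for classes *)

Section ClassSets.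
Variables (M : structure) (X : set (set M)) (hX : GB X).
Let hZF : ZF M := GB_ZF hX.
Let hEC : ElementaryComprehension X := GB_comprehension hX.
Local Notation pr := (pr hZF).
Local Notation zeroM := (zeroM hZF).
Local Notation suc := (suc hZF).

(** Class Replacement for the identity function restricted to [C]. *)
Lemma class_separation (C : set M) (a : M) : X C ->
  exists b, forall x, x ∈ b <-> x ∈ a /\ C x.
Proof.
move=> hC.
have hF : X [set p | exists x, p = pr x x /\ C x] by EC_solve.
have [||b hb] := GB_replacement hX a hF.
- by move=> p [x [-> _]]; exists x, x; apply/is_pairE.
- by move=> x y y' /relE[z [/pr_inj[-> ->] _]] /relE[z' [/pr_inj[-> ->] _]].
exists b => x; rewrite hb; split=> [[y [hy]]|[ha hCx]].
  by move=> /relE[z [/pr_inj[yz xz] hz]]; split; rewrite xz // -yz.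
by exists x; split=> //; apply/relE; exists x.
Qed.

Lemma EC_omega (K : set (set M)) : ElementaryComprehension K -> K (omega M).
Proof. by move=> hK; rewrite /omega /inductive /is_zero /is_succ; EC_solve. Qed.
Let hom : X (omega M) := EC_omega hEC.

Lemma omega0 : omega M zeroM.
Proof. by move=> I [[z [/is_zeroE ->]]]. Qed.

Lemma omegaS n : omega M n -> omega M (suc n).
Proof. by move=> hn I hI; have /hI.2[y [/is_succE ->]] := hn I hI. Qed.

Lemma exists_omega : exists w : M, forall n, n ∈ w <-> omega M n.
Proof.
have [I hI] := ZF_infinity hZF.
have [w hw] := class_separation I hom; exists w => n; rewrite hw.
by split=> [[]//|hn]; split=> //; apply: hn.
Qed.

(** [omega] is defined through inductive sets, so [C] is first cut down to a set by class
    separation. *)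
Lemma omega_ind (C : set M) : X C -> C zeroM ->
  (forall n, omega M n -> C n -> C (suc n)) -> forall n, omega M n -> C n.
Proof.
move=> hC h0 hS n hn; have [w hw] := exists_omega.
have [b hb] := class_separation w hC.
suff /hn/hb[] : inductive b by [].
split.
  by exists zeroM; rewrite is_zeroE hb hw; do !split=> //; apply: omega0.
move=> x /hb[/hw hx hCx]; exists (suc x); rewrite is_succE hb hw.
by do !split=> //; [apply: omegaS|apply: hS].
Qed.

Lemma omega_min (C : set M) : X C -> (exists n, omega M n /\ C n) ->
  exists n, [/\ omega M n, C n & forall m, omega M m -> C m -> ~ m ∈ n].
Proof.
move=> hC [n [hn hCn]]; have [w hw] := exists_omega.
have [b hb] := class_separation w hC.
have [|m [/hb[/hw hm hCm] h]] := ZF_foundation hZF (a := b).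
  by exists n; rewrite hb hw.
by exists m; split=> // k hk hCk; apply: h; rewrite hb hw.
Qed.

Lemma omega_trans n k l : omega M n -> k ∈ n -> l ∈ k -> l ∈ n.
Proof.
move=> hn; move: n hn k l; apply: omega_ind.
- by EC_solve.
- by move=> k l /mem_zero.
- by move=> n hn ih k l /mem_suc[/ih h /h ?|-> ?]; apply/mem_suc; left.
Qed.

Lemma omega_suc_le n k : omega M n -> k ∈ n -> suc k ∈ n \/ suc k = n.
Proof.
move=> hn; move: n hn k; apply: omega_ind.
- by EC_solve.
- by move=> k /mem_zero.
- move=> n hn ih k /mem_suc[/ih[h|h]|->]; last by right.
    by left; apply/mem_suc; left.
  by left; apply/mem_suc; right.
Qed.

Lemma omega_total n m : omega M n -> omega M m -> n ∈ m \/ n = m \/ m ∈ n.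
Proof.
move=> hn; move: n hn m; apply: omega_ind.
- by EC_solve.
- apply: omega_ind.
  + by EC_solve.
  + by right; left.
  + by move=> m hm [h|[<-|/mem_zero//]]; left; apply/mem_suc; [left|right].
- move=> n hn ih m hm; case: (ih m hm) => [h|[<-|h]].
  + by case: (omega_suc_le hm h) => ?; [left|right; left].
  + by right; right; apply/mem_suc; right.
  + by right; right; apply/mem_suc; left.
Qed.

(** The sequence may have nonstandard length, so the induction runs inside the model, on the
    position [k]; hence [Q] has to be a class of [X]. *)
Lemma tc_sub (R Q : set M) : X Q ->
  (forall x y z, related Q x y -> related Q y z -> related Q x z) ->
  (forall x y, related R x y -> related Q x y) ->
  forall x y, trans_closure R x y -> related Q x y.
Proof.
move=> hQ Qtr RQ x y [n [n' [f [[hn n0 /is_succE n'E [_ fun_f]] [f0 fn fS]]]]].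
have fu k u v : k ∈ n' -> related (ext f) k u -> related (ext f) k v -> u = v.
  by move=> /fun_f[w [_ hw]] /hw <- /hw <-.
have fx : related (ext f) zeroM x by case: f0 => z [/is_zeroE ->].
(* Position 0 is set apart: its value is [x], and [Q] need not relate [x] to itself. *)
have main k : omega M k -> k ∈ n' -> k = zeroM \/
    (forall v, related (ext f) k v -> related Q x v).
  move: k; apply: omega_ind; first by rewrite /related /ext; EC_solve.
    by left.
  move=> k hk ih hSk; right=> v hv.
  have kn : k ∈ n.
    move: hSk; rewrite n'E => /mem_suc[/omega_trans|<-]; last by apply/mem_suc; right.
    by apply=> //; apply/mem_suc; right.
  have kn' : k ∈ n' by rewrite n'E; apply/mem_suc; left.
  have [u [hu _]] := fun_f k kn'.
  have uv : related Q u v by apply/RQ/(fS k (suc k)) => //; apply/is_succE.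
  case: (ih kn') => [k0|/(_ u hu)]; last by move/Qtr; apply.
  by rewrite (fu zeroM x u) // -k0.
case: (main n hn _) => [|/is_zeroE//|]; last exact.
by rewrite n'E; apply/mem_suc; right.
Qed.

Lemma tc_sub1 (R : set M) x y : related R x y -> trans_closure R x y.
Proof.
move=> Rxy; pose one := suc zeroM.
exists one, (suc one), (upair hZF (pr zeroM x) (pr one y)).
have fE k v : related (ext (upair hZF (pr zeroM x) (pr one y))) k v <->
    (k = zeroM /\ v = x) \/ (k = one /\ v = y).
  rewrite relE /ext /= mem_upair; split=> [[|] /pr_inj[-> ->]|].
  - by left.
  - by right.
  - by move=> [] [-> ->]; [left|right].
have one0 : one <> zeroM by exact: suc_neq0.
split; split=> //.
- exact/omegaS/omega0.
- by move=> /is_zeroE.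
- exact/is_succE.
- split=> [p /= /mem_upair[] ->|k].
  + exists zeroM, x; split=> //; first exact/is_pairE.
    by rewrite /ext /= mem_suc mem_suc; left; right.
  + exists one, y; split=> //; first exact/is_pairE.
    by rewrite /ext /= mem_suc; right.
  + move=> /mem_suc[/mem_suc[/mem_zero//|]|] ->.
      by exists x; split; [apply/fE; left|move=> v /fE[[]|[/esym]]].
    by exists y; split; [apply/fE; right|move=> v /fE[[]|[]]].
- by exists zeroM; split; [exact/is_zeroE|apply/fE; left].
- by apply/fE; right.
- move=> k k' u v /mem_suc[/mem_zero//|->] /is_succE -> /fE[[_ ->]|[/esym//]].
  by move=> /fE[[]|[_ ->]].
Qed.

Lemma tc_trans (R : set M) : X R ->
  (forall x y z, related R x y -> related R y z -> related R x z) ->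
  forall x y, trans_closure R x y <-> related R x y.
Proof. by move=> hR Rtr x y; split; [apply: tc_sub|apply: tc_sub1]. Qed.

(** The sequences witnessing the closure are sets, so its definition has no class quantifier. *)
Lemma EC_tc (K : set (set M)) (R : set M) : ElementaryComprehension K -> K R ->
  K [set p | exists x y, p = pr x y /\ trans_closure R x y].
Proof.
move=> hK hR; have homK := EC_omega hK.
rewrite /trans_closure /is_zero /is_succ /is_function /unique /ext /related /setT.
EC_solve.
Qed.

End ClassSets.

(** * The definability hierarchy *)

Section Operations.
Variables (M : structure) (hZF : ZF M).
Local Notation pr := (pr hZF).
Local Notation tg := (tg hZF).
Local Notation zeroM := (zeroM hZF).

(** [z] is the function [y] with its value at [a] changed to [x]. *)
Definition update (z y a x : M) : Prop :=
  forall q, q ∈ z <-> q = pr a x \/ (q ∈ y /\ ~ exists x', q = pr a x').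

(** [k] is a pair of a level and an index at that level. *)
Definition coded_class (T : set M) (k : M) : set M :=
  [set y | exists u j, k = pr u j /\ T (pr u (pr j y))].

(** One layer of first-order definability over the classes coded in [T] and the
    parameter [A]. Operations 2 to 6 mirror the clauses of satisfaction, with
    environments as functions [y] from names of variables to values; operation
    7 specialises a class of environments to a class, by letting one variable
    range and fixing the others as in [c]. *)
Definition op (T A : set M) (k : nat) (d y : M) : Prop :=
  match k with
  | 0 => T y
  | 1 => A (pr d y)
  | 2 => exists a b x z,
           [/\ d = pr a b, pr a x ∈ y, pr b z ∈ y & x ∈ z]
  | 3 => exists a b x, [/\ d = pr a b, pr a x ∈ y & pr b x ∈ y]
  | 4 => exists a k x, [/\ d = pr a k, pr a x ∈ y & coded_class T k x]
  | 5 => exists k l, d = pr k l /\ (coded_class T k y -> coded_class T l y)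
  | 6 => exists a k, d = pr a k /\
           forall x z, update z y a x -> coded_class T k z
  | 7 => exists c a k, d = pr c (pr a k) /\
           forall z, update z c a y -> coded_class T k z
  | _ => False
  end.

(** A finite disjunction in recursive form: [step_op] treats all operations at once by induction on
    [n], while unfolding at a numeral yields a formula. *)
Fixpoint ops (T A : set M) (n : nat) (p : M) : Prop :=
  if n is k.+1 then
    (exists d y, p = pr (pr (tg k) d) y /\ op T A k d y) \/ ops T A k p
  else False.

Definition step (T A : set M) : set M := [set p | ops T A 8 p].

Lemma step_op T A k d y : step T A (pr (pr (tg k) d) y) <-> op T A k d y.
Proof.
have opsE n : ops T A n (pr (pr (tg k) d) y) <-> k < n /\ op T A k d y.
  elim: n => [|n ih] /=; first by split=> // -[].
  rewrite ih ltnS (leq_eqVlt k n); split=> [[|[kn h]]|[/orP[/eqP <-|kn] h]].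
  - move=> [d' [y' [/pr_inj[/pr_inj[/tg_inj -> ->] ->] h]]].
    by rewrite eqxx.
  - by rewrite kn orbT.
  - by left; exists d, y.
  - by right.
rewrite /step /mkset opsE.
(* From number 8 on, [op] is [False]. *)
split=> [[]//|h]; split=> //; rewrite ltnNge; apply/negP => k8.
by move: h; rewrite -(subnKC k8).
Qed.

Lemma step_formula : exists phi : formula 2 1, forall T A x, step T A x <->
  sat (fun k : 'I_2 => if k == ord0 then T else A) phi (fun=> x).
Proof.
apply: formula_of_dfn2.
rewrite /step /mkset /ops /op /update /coded_class /mkset.
by dfn_solve.
Qed.

(** The variable [i] of a formula in [n] variables has name [tg (n - i.+1)], so
    that names do not change under quantifiers. *)
Definition codes_env n (s : 'I_n -> M) (c : M) : Prop :=
  forall q, q ∈ c <-> exists i : 'I_n, q = pr (tg (n - i.+1)) (s i).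

Lemma codes_env_val n (s : 'I_n -> M) c (i : 'I_n) x : codes_env s c ->
  pr (tg (n - i.+1)) x ∈ c <-> x = s i.
Proof.
move=> hc; rewrite hc; split=> [[j /pr_inj[/tg_inj ij ->]]|->]; last by exists i.
suff -> : i = j by [].
apply/val_inj/eqP; rewrite -eqSS -(eqn_add2l (n - i.+1)) subnK //.
by rewrite ij subnK.
Qed.

(** The new variable 0 is named [tg n]. An old variable moves from [i] to [i + 1] as [n] grows by
    one, so its name stays. The names in [c] are all different from [tg n], so the update overwrites
    nothing. *)
Lemma codes_env_fcons n (s : 'I_n -> M) c x z :
  codes_env s c -> update z c (tg n) x <-> codes_env (fcons x s) z.
Proof.
move=> hc; suff h q : (q = pr (tg n) x \/
    q ∈ c /\ ~ (exists x', q = pr (tg n) x')) <->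
    exists i : 'I_n.+1, q = pr (tg (n.+1 - i.+1)) (fcons x s i).
  by split=> hz q; rewrite hz h.
split=> [[->|[/hc[i ->] _]]|[i ->]].
- by exists ord0; rewrite /fcons unlift_none subSS subn0.
- by exists (lift ord0 i); rewrite /fcons liftK subSS.
- rewrite /fcons; case: unliftP => [j ->|->]; last by left; rewrite subSS subn0.
  right; rewrite subSS lift0; split; first by apply/hc; exists j.
  move=> [x' /pr_inj[/tg_inj/eqP]]; rewrite -[X in _ == X]subn0.
  by rewrite eqn_sub2lE // ltn_ord.
Qed.

End Operations.

(** * Levels of the hierarchy and comprehension *)

Section Hierarchy.
Variables (M : structure) (X : set (set M)) (hX : GB X).
Let hZF : ZF M := GB_ZF hX.
Let hEC : ElementaryComprehension X := GB_comprehension hX.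
Local Notation pr := (pr hZF).
Local Notation tg := (tg hZF).
Local Notation zeroM := (zeroM hZF).

Lemma exists_update (y a x : M) : exists z, update hZF z y a x.
Proof.
have hC : X [set q | ~ exists x', q = pr a x'] by EC_solve.
have [b hb] := class_separation hX y hC.
have [z hz] := exists_union2 hZF (upair hZF (pr a x) (pr a x)) b.
exists z => q; rewrite hz hb mem_upair /=; split; last by tauto.
by case=> [[] ->|]; [left|left|right].
Qed.

Lemma exists_codes_env n (s : 'I_n -> M) : exists c, codes_env hZF s c.
Proof.
elim: n s => [|n ih] s.
  by exists zeroM => q; split=> [/mem_zero//|[[]]].
have [c hc] := ih (fun i => s (lift ord0 i)).
have [z] := exists_update c (tg n) (s ord0).
rewrite (codes_env_fcons _ _ hc) => hz; exists z.
have -> // : s = fcons (s ord0) (fun i => s (lift ord0 i)).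
by apply/funext => i; rewrite /fcons; case: unliftP => [j|] ->.
Qed.

Variables (L A S : set M).

Definition below (u : M) : set M :=
  [set q | exists u' y, [/\ q = pr u' y, related L u' u & S q]].

Definition hierarchy : Prop :=
  forall u p, dom L u -> S (pr u p) <-> step hZF (below u) A p.

Definition lev (u j : M) : set M := [set y | S (pr u (pr j y))].

Definition levels (I : set M) : set (set M) :=
  [set C | exists u j, I u /\ C = lev u j].

Hypothesis hS : hierarchy.

Lemma lev_op u k d y : dom L u ->
  lev u (pr (tg k) d) y <-> op hZF (below u) A k d y.
Proof. by move=> hu; rewrite /lev /= hS // step_op. Qed.

Lemma coded_below u u' j y :
  coded_class hZF (below u) (pr u' j) y <-> related L u' u /\ lev u' j y.
Proof.
split=> [[v [i [/pr_inj[-> ->] [v' [z [/pr_inj[-> _] vu hv]]]]]]//|[h h']].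
by exists u', j; split=> //; exists u', (pr j y).
Qed.

(** Operations 0 and 1 put the history before [u] and the slices of the parameter into every level,
    so they stay available further up. *)
Lemma lev_below u : dom L u -> lev u (pr (tg 0) zeroM) = below u.
Proof. by move=> hu; apply/predeqP => y; rewrite lev_op. Qed.

Lemma lev_slice u a : dom L u -> lev u (pr (tg 1) a) = slice A a.
Proof. by move=> hu; apply/predeqP => y; rewrite lev_op // (sliceE hZF). Qed.

Section Comprehension.
Variable I : set M.
Hypotheses (I_dom : I `<=` dom L) (I_n0 : I !=set0).
Hypothesis I_dir : forall u v, I u -> I v ->
  exists w, [/\ I w, related L u w & related L v w].

(** Each logical connective costs one level above those of its subformulas, and [I_dir] supplies it.
    The index depends on the formula and the class parameters but not on the environment. *)
Lemma levels_formula m n (phi : formula m n) (B : 'I_m -> set M) :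
  (forall k, levels I (B k)) ->
  exists u j, I u /\
    forall s c, codes_env hZF s c -> lev u j c <-> sat B phi s.
Proof.
move=> hB; have [u0 hu0] := I_n0; elim: phi => {}n /=.
- move=> i j; exists u0, (pr (tg 2) (pr (tg (n - i.+1)) (tg (n - j.+1)))).
  split=> // s c hc; rewrite lev_op; last exact: I_dom.
  split=> [[a [b [x [z [/pr_inj[<- <-]]]]]]|h].
    by rewrite !codes_env_val // => -> ->.
  exists (tg (n - i.+1)), (tg (n - j.+1)), (s i), (s j).
  by split=> //; apply/codes_env_val.
- move=> i j; exists u0, (pr (tg 3) (pr (tg (n - i.+1)) (tg (n - j.+1)))).
  split=> // s c hc; rewrite lev_op; last exact: I_dom.
  split=> [[a [b [x [/pr_inj[<- <-]]]]]|h].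
    by rewrite !codes_env_val // => <- <-.
  exists (tg (n - i.+1)), (tg (n - j.+1)), (s i).
  by split=> //; apply/codes_env_val.
- move=> i k; have [v [l [hv ->]]] := hB k.
  have [u [hu vu _]] := I_dir hv hv.
  exists u, (pr (tg 4) (pr (tg (n - i.+1)) (pr v l))).
  split=> // s c hc; rewrite lev_op; last exact: I_dom.
  split=> [[a [b [x [/pr_inj[<- <-]]]]]|h].
    by rewrite codes_env_val // => -> /coded_below[].
  exists (tg (n - i.+1)), (pr v l), (s i).
  by split=> //; [apply/codes_env_val|apply/coded_below].
(* Tag 8 belongs to no operation, so this index codes the empty class. *)
- exists u0, (pr (tg 8) zeroM); split=> // s c _; rewrite lev_op //.
  exact: I_dom.
- move=> phi [u [j [hu hphi]]] psi [v [l [hv hpsi]]].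
  have [w [hw uw vw]] := I_dir hu hv.
  exists w, (pr (tg 5) (pr (pr u j) (pr v l))).
  split=> // s c hc; rewrite lev_op; last exact: I_dom.
  rewrite -hphi // -hpsi //; split=> [[a [b [/pr_inj[<- <-]]]]|h].
    by rewrite !coded_below => h hu'; apply: (h _).2.
  exists (pr u j), (pr v l); split=> //.
  by rewrite !coded_below => -[_ /h].
- move=> phi [u [j [hu hphi]]]; have [w [hw uw _]] := I_dir hu hu.
  exists w, (pr (tg 6) (pr (tg n) (pr u j))).
  split=> // s c hc; rewrite lev_op; last exact: I_dom.
  split=> [[a [b [/pr_inj[<- <-]] h]] x|h].
    have [z hz] := exists_update c (tg n) x.
    have /coded_below[_] := h _ _ hz.
    by rewrite (hphi _ _ ((codes_env_fcons x z hc).1 hz)).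
  exists (tg n), (pr u j); split=> // x z /(codes_env_fcons _ _ hc) hz.
  by rewrite coded_below (hphi _ _ hz).
Qed.

(** One more level applies operation 7: [c] holds the set parameters, and the variable named [tg n]
    ranges over the class being defined. *)
Lemma levels_EC : ElementaryComprehension (levels I).
Proof.
move=> m n phi B s hB; have [u [j [hu hphi]]] := levels_formula phi hB.
have [c hc] := exists_codes_env s; have [w [hw uw _]] := I_dir hu hu.
exists w, (pr (tg 7) (pr c (pr (tg n) (pr u j)))); split=> //.
apply/predeqP => x; rewrite lev_op; last exact: I_dom.
split=> [/= h|[c' [a [k [/pr_inj[<- /pr_inj[<- <-]] h]]]]] /=.
  exists c, (tg n), (pr u j); split=> // z /(codes_env_fcons _ _ hc) hz.
  by rewrite coded_below (hphi _ _ hz).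
have [z /[dup] hz /h /coded_below[_]] := exists_update c (tg n) x.
by rewrite (hphi _ _ ((codes_env_fcons x z hc).1 hz)).
Qed.

End Comprehension.
End Hierarchy.

(** * Recursion along a ranked relation *)

Lemma dfn_tc (M : structure) (X : set (set M)) (hX : GB X) (K : set (set M))
    (R : set M) n t t' :
  ElementaryComprehension K -> K R ->
  tdf (fun c : unit -> set M => K (c tt)) n t ->
  tdf (fun c : unit -> set M => K (c tt)) n t' ->
  dfn (fun c : unit -> set M => K (c tt)) n
    (fun w e => trans_closure R (t w e) (t' w e)).
Proof.
move=> hK hR ht ht'.
have := EC_tc hX hK hR; set C := [set _ | _] => hC.
have h := @dfn_cls _ _ (fun c : unit -> set M => K (c tt)) n (fun=> C) _ hC
  (tdf_pr (GB_ZF hX) ht ht').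
apply: dfn_ext h _ => w e; split=> [h|[x [y [/pr_inj[-> ->]]]]//].
by exists (t w e), (t' w e).
Qed.

Section Recursion.
Variables (M : structure) (X : set (set M)) (hX : GB X).
Let hZF : ZF M := GB_ZF hX.
Let hEC : ElementaryComprehension X := GB_comprehension hX.
Local Notation pr := (pr hZF).
Local Notation coded_class := (coded_class hZF).

Variables (phi : formula 2 1) (Gam A R F : set M).

Definition stage (P : set M) (r : M) : set M :=
  [set x | sat (fun k : 'I_2 => if k == ord0 then restr P R r else A)
               phi (fun=> x)].

Definition solves (P : set M) (r : M) : Prop :=
  forall x, P (pr r x) <-> stage P r x.

Definition le_of (d c : M) : Prop := d = c \/ related Gam d c.

Definition solves_upto (P : set M) (c : M) : Prop :=
  forall r d, related F r d -> le_of d c -> solves P r.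

(** Being a partial solution is a first-order property of a coded class, so the union of all those
    coded in [T] is defined by quantifying over their indices [k]. *)
Definition glue (T : set M) : set M :=
  [set p | exists r x d k, [/\ p = pr r x, related F r d,
     solves_upto (coded_class T k) d & coded_class T k p]].

Definition next_class (P : set M) : set M :=
  [set p | exists r x, p = pr r x /\ stage P r x].

Section Definability.
Variable K : set (set M).
Hypotheses (hK : ElementaryComprehension K) (kG : K Gam) (kA : K A) (kR : K R)
  (kF : K F).

Lemma EC_coded_class T k : K T -> K (coded_class T k).
Proof. by move=> hT; rewrite /coded_class; EC_solve. Qed.

Lemma EC_glue T : K T -> K (glue T).
Proof.
move=> hT; rewrite /glue /solves_upto /le_of /solves /stage /mkset.
rewrite /coded_class.
EC_solve.
apply: dfn_sat21 => //.
rewrite /restr /mkset.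
dfn_solve.
by apply: (dfn_tc hX) => //; tdf_solve.
Qed.

Lemma EC_next P : K P -> K (next_class P).
Proof.
move=> hP; rewrite /next_class /stage /mkset.
EC_solve.
apply: dfn_sat21 => //.
rewrite /restr /mkset.
dfn_solve.
by apply: (dfn_tc hX) => //; tdf_solve.
Qed.

End Definability.

Hypotheses (xG : X Gam) (xF : X F).
Hypothesis Gam_wo : class_well_order X Gam.
Hypothesis F_fun : is_function F (dom R) (dom Gam).
Hypothesis F_mono : forall r s d e,
  related R r s -> related F r d -> related F s e -> related Gam d e.

Lemma F_uniq r d e : related F r d -> related F r e -> d = e.
Proof.
move=> h; have Dr : dom R r.
  move: h => [p [/(is_pairE hZF) -> /F_fun.1[x [y [/(is_pairE hZF)]]]]].
  by move=> /pr_inj[-> _].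
by have [c [_ hc]] := F_fun.2 r Dr; move: h => /hc <- /hc <-.
Qed.

(** The order pulled back from [Gam] along [F] is a transitive class containing [R], so it contains
    the transitive closure by [tc_sub]. *)
Lemma F_tc r s d : trans_closure R r s -> related F s d ->
  exists2 e, related F r e & related Gam e d.
Proof.
have [_ Gtr _] := Gam_wo.
have hQ : X [set p | exists r s d e, [/\ p = pr r s, related F r d,
   related F s e & related Gam d e]] by EC_solve.
move=> rs sd; have := tc_sub hX hQ _ _ rs; case.
- move=> x y z /(relE hZF)[? [? [d1 [e1 [/pr_inj[<- <-] h1 h2 h3]]]]].
  move=> /(relE hZF)[? [? [d2 [e2 [/pr_inj[<- <-] h4 h5 h6]]]]].
  apply/(relE hZF); exists x, z, d1, e2; split=> //.
  by apply: Gtr h3 _; rewrite (F_uniq h2 h4).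
- move=> x y Rxy.
  have [u [xu _]] := F_fun.2 x (ex_intro _ y (or_introl Rxy)).
  have [v [yv _]] := F_fun.2 y (ex_intro _ x (or_intror Rxy)).
  apply/(relE hZF); exists x, y, u, v; split=> //.
  exact: F_mono Rxy xu yv.
- move=> p [/(is_pairE hZF) -> [? [? [e [d' [/pr_inj[<- <-] h1 h2 h3]]]]]].
  by exists e => //; rewrite (F_uniq sd h2).
Qed.

Lemma restr_ext (P P' : set M) r :
  (forall s x, trans_closure R s r -> P (pr s x) <-> P' (pr s x)) ->
  restr P R r = restr P' R r.
Proof.
move=> h; apply/predeqP => p; rewrite /restr /=.
split=> -[hp [s [x [/(is_pairE hZF) e hs]]]]; move: hp; rewrite e => /h hp;
  by split; [apply: hp|exists s, x; split=> //; apply/is_pairE].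
Qed.

Lemma stage_ext (P P' : set M) r :
  (forall s x, trans_closure R s r -> P (pr s x) <-> P' (pr s x)) ->
  stage P r = stage P' r.
Proof. by move=> h; rewrite /stage (restr_ext h). Qed.

Lemma wf_least (D : set M) : X D -> D !=set0 ->
  exists x, D x /\ forall y, D y -> ~ related Gam y x.
Proof. by have [[_ h] _ _] := Gam_wo => hD /h; apply. Qed.

Lemma solution_uniq (J P P' : set M) : X J -> X P -> X P' ->
  (forall d e, J d -> related Gam e d -> J e) ->
  (forall r d, related F r d -> J d -> solves P r) ->
  (forall r d, related F r d -> J d -> solves P' r) ->
  forall r d x, related F r d -> J d -> P (pr r x) <-> P' (pr r x).
Proof.
move=> hJ hP hP' Jdown sP sP' r d x rd Jd; apply: contrapT => neq.
have hD : X [set d | J d /\ exists r x, related F r d /\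
  ~ (P (pr r x) <-> P' (pr r x))] by EC_solve.
case: (wf_least hD); first by exists d; split=> //; exists r, x.
move=> c [[Jc [s [y [sc nq]]]] cmin]; apply: nq.
rewrite (sP s c) // (sP' s c) // (@stage_ext P P') // => t z ts.
have [e te ec] := F_tc ts sc; apply: contrapT => neq'.
apply: (cmin e _ ec); split; first exact: Jdown ec.
by exists t, z.
Qed.

Lemma le_of_trans c d e : le_of c d -> le_of d e -> le_of c e.
Proof.
have [_ Gtr _] := Gam_wo.
by move=> [->//|cd] [<-|de]; right => //; apply: Gtr de.
Qed.

Lemma solves_upto_le P c d : solves_upto P c -> le_of d c -> solves_upto P d.
Proof. by move=> h dc r e re ed; apply: (h r e re); apply: le_of_trans dc. Qed.

(** By uniqueness, all partial solutions coded in [T] agree at [r], whichever index [glue] picks. *)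
Lemma glue_coded T k c r d x : X T -> solves_upto (coded_class T k) c ->
  related F r d -> le_of d c -> glue T (pr r x) <-> coded_class T k (pr r x).
Proof.
move=> hT hk rd dc; split=> [[s [y [e [l [/pr_inj[rs xy] re hl hx]]]]]|]; last first.
  by move=> h; exists r, x, d, k; split=> //; apply: solves_upto_le dc.
subst s y; move: (F_uniq re rd) => ed; subst e.
have hJ : X (le_of^~ d) by rewrite /le_of; EC_solve.
have xk := EC_coded_class hEC k hT; have xl := EC_coded_class hEC l hT.
suff /iffRL : coded_class T k (pr r x) <-> coded_class T l (pr r x) by apply.
apply: (solution_uniq hJ xk xl _ _ hl x rd); last by left.
- by move=> c' e h ec; apply: le_of_trans h; right.
- exact: solves_upto_le dc.
Qed.

Lemma glue_solves T r d : X T -> related F r d ->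
  (exists k, solves_upto (coded_class T k) d) -> solves (glue T) r.
Proof.
move=> hT rd [k hk] x; have dd : le_of d d by left.
rewrite (glue_coded x hT hk rd dd) (hk r d rd dd x).
rewrite (@stage_ext _ (glue T)) // => s y sr.
have [e se ed] := F_tc sr rd; apply: iff_sym.
by apply: (glue_coded y hT hk se); right.
Qed.

(** Possibly no class coded in [T] reaches rank [c]. But a stage at rank [c] only looks at lower
    ranks, where [glue T] solves the recursion and thus equals [next_class (glue T)]. *)
Lemma next_glue_solves T c : X T ->
  (forall d, related Gam d c -> exists k, solves_upto (coded_class T k) d) ->
  solves_upto (next_class (glue T)) c.
Proof.
have [_ Gtr _] := Gam_wo.
move=> hT h r d rd dc x.
have nE s y : next_class (glue T) (pr s y) <-> stage (glue T) s y.
  by split=> [[? [? [/pr_inj[-> ->]]]]//|?]; exists s, y.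
rewrite nE (@stage_ext _ (next_class (glue T))) // => s y sr; rewrite nE.
have [e se ed] := F_tc sr rd; apply: (glue_solves hT se); apply: h.
by case: dc => [<-//|]; apply: Gtr.
Qed.

End Recursion.

(** * The product with omega *)

Section WellOrders.
Variables (M : structure) (X : set (set M)) (hX : GB X).
Let hZF : ZF M := GB_ZF hX.
Let hEC : ElementaryComprehension X := GB_comprehension hX.
Local Notation pr := (pr hZF).
Local Notation zeroM := (zeroM hZF).
Local Notation suc := (suc hZF).

Lemma wo_irrefl (L : set M) x : class_well_order X L -> ~ related L x x.
Proof.
move=> [[_ wf] _ _] hx; have h1 := EC_set1 x hEC.
have [|y [-> h]] := wf _ h1; first by exists x.
exact: (h x).
Qed.

(** The identity is the rank function. The family [K] is arbitrary, as the rank function is wanted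
    both in the given model and in the smaller one. *)
Lemma rank_le_refl (K : set (set M)) (L : set M) :
  ElementaryComprehension K -> K L -> class_well_order X L -> rank_le K L L.
Proof.
move=> hK hL wo; have [_ Ltr Ltot] := wo.
have hF : K [set p | exists x, p = pr x x /\ dom L x].
  by rewrite /dom; EC_solve.
set F := [set p | _] in hF.
have FE x y : related F x y <-> x = y /\ dom L x.
  rewrite (relE hZF); split=> [[z [/pr_inj[-> ->]]]//|[<- h]].
  by exists x.
exists F; split=> //; split; first split.
- by move=> p [x [-> h]]; exists x, x; split=> //; apply/is_pairE.
- by move=> x hx; exists x; split; [apply/FE|move=> y /FE[]].
- move=> x d /FE[<- hx]; split=> [y e yx /FE[<- //]|c hc ac].
  case: (Ltot x c hx hc) => [|[|cx]]; [by right|by left|].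
  case: (wo_irrefl wo (ac c c cx _)); apply/FE; split=> //.
Qed.

Variable Gam : set M.
Hypotheses (xG : X Gam) (Gam_wo : class_well_order X Gam).
Local Notation L := (times_omega Gam).

Lemma times_omegaE n a m b : related L (pr n a) (pr m b) <->
  [/\ omega M n, omega M m, dom Gam a, dom Gam b &
      n ∈ m \/ (n = m /\ related Gam a b)].
Proof.
rewrite (relE hZF); split.
  move=> [u [v [/(is_pairE hZF)/pr_inj[<- <-]]]].
  move=> [n' [a' [m' [b' [[/(is_pairE hZF)/pr_inj[<- <-]]]]]]].
  by move=> /(is_pairE hZF)/pr_inj[<- <-] ? ? [].
move=> [hn hm ha hb h]; exists (pr n a), (pr m b); split; first exact/is_pairE.
by exists n, a, m, b; split; split=> //; apply/is_pairE.
Qed.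

Lemma times_omega_pairs u v : related L u v -> exists n a m b,
  u = pr n a /\ v = pr m b.
Proof.
move=> /(relE hZF)[u' [v' [/(is_pairE hZF)/pr_inj[<- <-]]]].
move=> [n [a [m [b [[/(is_pairE hZF) -> /(is_pairE hZF) -> _ _] _]]]]].
by exists n, a, m, b.
Qed.

Lemma dom_times_omega u : dom L u <->
  exists n a, [/\ u = pr n a, omega M n & dom Gam a].
Proof.
split=> [[v [h|h]]|[n [a [-> hn ha]]]].
- have [n [a [m [b [uE vE]]]]] := times_omega_pairs h.
  by move: h; rewrite uE vE => /times_omegaE[]; exists n, a.
- have [n [a [m [b [vE uE]]]]] := times_omega_pairs h.
  by move: h; rewrite uE vE => /times_omegaE[]; exists m, b.
exists (pr (suc n) a); left; apply/times_omegaE; split=> //.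
- exact: omegaS.
- by left; apply/mem_suc; right.
Qed.

Lemma EC_times_omega (K : set (set M)) :
  ElementaryComprehension K -> K Gam -> K L.
Proof.
move=> hK hG; have hom := EC_omega hK.
by rewrite /times_omega /lex_lt /dom; EC_solve.
Qed.

Lemma times_omega_trans u v w :
  related L u v -> related L v w -> related L u w.
Proof.
have [_ Gtr _] := Gam_wo.
move=> uv vw; have [n [a [m [b [uE vE]]]]] := times_omega_pairs uv.
have [_ [_ [k [c [_ wE]]]]] := times_omega_pairs vw.
move: uv vw; rewrite uE vE wE.
move=> /times_omegaE[hn hm ha hb h] /times_omegaE[_ hk _ hc h'].
apply/times_omegaE; split=> //.
case: h h' => [nm|[-> ab]] [mk|[<- bc]]; [left|by left|by left|right].
  exact: (omega_trans hX hk mk nm).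
by split=> //; apply: Gtr bc.
Qed.

Lemma times_omega_wo : class_well_order X L.
Proof.
have [[_ Gwf] Gtr Gtot] := Gam_wo.
split; [split|exact: times_omega_trans|].
- by move=> p [u [v [h _]]]; exists u, v.
- move=> D hD [x Dx]; have hom := EC_omega hEC.
  (* [D] may contain points outside the field of the order; a point without predecessors is minimal
     at once. *)
  have [[y yx]|nx] := pselect (exists y, related L y x); last first.
    by exists x; split=> // y _ yx; apply: nx; exists y.
  have hE : X [set n | exists a, dom Gam a /\ D (pr n a)].
    by rewrite /dom; EC_solve.
  case: (omega_min hX hE).
    have /dom_times_omega[n [a [xE hn ha]]] : dom L x by exists y; right.
    by exists n; split=> //; exists a; rewrite -xE.
  move=> n [hn [a [ha Da]] nmin].
  have hE' : X [set a | dom Gam a /\ D (pr n a)] by rewrite /dom; EC_solve.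
  case: (Gwf _ hE'); first by exists a.
  move=> b [[hb Db] bmin]; exists (pr n b); split=> // z Dz zb.
  have [m [c [_ [_ [zE _]]]]] := times_omega_pairs zb.
  move: zb Dz; rewrite zE => /times_omegaE[hm _ hc _ [mn|[-> cb]]] Dz.
    by apply: (nmin m hm _ mn); exists c.
  exact: (bmin c _ cb).
- move=> u v /dom_times_omega[n [a [-> hn ha]]].
  move=> /dom_times_omega[m [b [-> hm hb]]].
  case: (omega_total hX hn hm) => [nm|[<-|mn]].
  + by left; apply/times_omegaE; split=> //; left.
  + case: (Gtot a b ha hb) => [ab|[->|ba]]; [left|by right; left|right; right].
      by apply/times_omegaE; split=> //; right.
    by apply/times_omegaE; split=> //; right.
  + by right; right; apply/times_omegaE; split=> //; left.
Qed.

Lemma times_omega_dir u v : dom L u -> dom L v ->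
  exists w, [/\ dom L w, related L u w & related L v w].
Proof.
have up x : dom L x -> exists w, related L x w.
  move=> /dom_times_omega[n [a [-> hn ha]]]; exists (pr (suc n) a).
  by apply/times_omegaE; split=> //; [exact: omegaS|left; apply/mem_suc; right].
have [_ _ Ltot] := times_omega_wo.
move=> hu hv; case: (Ltot u v hu hv) => [uv|[<-|vu]].
- have [w vw] := up v hv; exists w; split=> //; first by exists v; right.
  exact: times_omega_trans vw.
- by have [w uw] := up u hu; exists w; split=> //; exists u; right.
- have [w uw] := up u hu; exists w; split=> //; first by exists u; right.
  exact: times_omega_trans uw.
Qed.

(** The least element qualifies vacuously; closure under comprehension is only claimed with some [u]
    below [v]. *)
Definition limit (v : M) : Prop :=
  dom L v /\ forall u, related L u v -> exists w, related L u w /\ related L w v.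

Lemma limit_dir v : limit v -> forall u u', related L u v -> related L u' v ->
  exists w, [/\ related L w v, related L u w & related L u' w].
Proof.
have [_ _ Ltot] := times_omega_wo.
move=> [_ hv] u u' uv uv'.
have hu : dom L u by exists v; left.
have hu' : dom L u' by exists v; left.
case: (Ltot u u' hu hu') => [uu'|[<-|uu']].
- have [w [uw wv]] := hv _ uv'; exists w; split=> //.
  exact: times_omega_trans uw.
- by have [w [uw wv]] := hv _ uv; exists w.
- have [w [uw wv]] := hv _ uv; exists w; split=> //.
  exact: times_omega_trans uw.
Qed.

Lemma limit_pair n c : omega M n -> (exists b, related Gam b c) ->
  (forall a, related Gam a c -> exists b, related Gam a b /\ related Gam b c) ->
  limit (pr n c).
Proof.
move=> hn [b bc] hc; have Dc : dom Gam c by exists b; right.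
have Db : dom Gam b by exists c; left.
split=> [|u uc]; first by apply/dom_times_omega; exists n, c.
have [m [a [_ [_ [uE _]]]]] := times_omega_pairs uc.
move: uc; rewrite uE => /times_omegaE[hm _ Da _ [mn|[-> ac]]].
  exists (pr n b); split; apply/times_omegaE; split=> //; first by left.
  by right.
have [d [ad dc]] := hc a ac; have Dd : dom Gam d by exists a; right.
by exists (pr n d); split; apply/times_omegaE; split=> //; right.
Qed.

(** An initial segment of order type omega. *)
Lemma ge_omega_segment : ge_omega_omega X Gam ->
  exists B : set M, [/\ X B, B !=set0 & B `<=` dom Gam] /\
    (forall y y', B y -> related Gam y' y -> B y') /\
    (forall y, B y -> exists y', B y' /\ related Gam y y').
Proof.
(* Here [b] is [f(0) = 1] and [c] is [f(1)], a copy of omega below [a]; the segment is the image of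
   [c] under [E]. *)
move=> [a [[f [f_fun f0 fS aE]] [E [xE [[E_fun E_mono] E_init]]]]].
have [b [fb _]] := f_fun.2 zeroM (omega0 hX).
have bE : b = suc zeroM by apply/is_succE/(f0 zeroM) => //; apply/is_zeroE.
have [c [fc _]] := f_fun.2 (suc zeroM) (omegaS hX (omega0 hX)).
have [[ctr _] [g [[g_fun g_mono] g_onto]]] : is_ord_times_omega c b.
  by apply: (fS zeroM (suc zeroM)) => //; [apply: omega0|apply/is_succE].
have ca x : x ∈ c -> x ∈ a by move=> xc; apply/aE; exists (suc zeroM), c.
have Edom x y : related E x y -> x ∈ a /\ dom Gam y.
  move=> [p [/(is_pairE hZF) -> /E_fun.1[x' [y' [/(is_pairE hZF)]]]]].
  by move=> /pr_inj[-> ->].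
have gdom u x : related (ext g) u x -> lex_dom (ext b) u /\ x ∈ c.
  move=> [p [/(is_pairE hZF) -> /g_fun.1[x' [y' [/(is_pairE hZF)]]]]].
  by move=> /pr_inj[-> ->].
have lexb n : omega M n -> lex_dom (ext b) (pr n zeroM).
  move=> hn; exists n, zeroM; split=> //; first exact/is_pairE.
  by rewrite /ext bE /=; apply/mem_suc; right.
exists [set y | exists x, x ∈ c /\ related E x y]; split; split.
- by EC_solve.
- have [x [gx _]] := g_fun.2 _ (lexb _ (omega0 hX)).
  have [_ xc] := gdom _ _ gx; have [y [xy _]] := E_fun.2 x (ca x xc).
  by exists y, x.
- by move=> y [x [_ /Edom[]]].
- move=> y y' [x [xc xy]] y'y; have Dy' : dom Gam y' by exists y; left.
  have [x' xy'] := E_init x y y' xy Dy' y'y.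
  exists x'; split=> //; apply: (ctr x) => //.
  exact/(E_mono _ _ _ _ xy' xy).
(* As [b] only contains zero, [x] corresponds to a pair [(n, 0)], and [(n + 1, 0)] gives a larger
   element. *)
- move=> y [x [xc xy]]; have [u gu] := g_onto x xc.
  have [[n [z [/(is_pairE hZF) uE hn]]]] := gdom _ _ gu.
  rewrite /ext bE /= => /mem_suc[/mem_zero//|z0] _.
  have [x' [gx' _]] := g_fun.2 _ (lexb _ (omegaS hX hn)).
  have [_ xc'] := gdom _ _ gx'; have [y' [xy' _]] := E_fun.2 x' (ca x' xc').
  exists y'; split; first by exists x'.
  apply/(E_mono _ _ _ _ xy xy')/(g_mono _ _ _ _ gu gx').
  have bz : z ∈ b by rewrite bE z0; apply/mem_suc; right.
  have bz' : zeroM ∈ b by rewrite -z0.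
  exists n, z, (suc n), zeroM; split; split=> //; try exact/is_pairE.
  + exact: omegaS.
  + by left; apply/mem_suc; right.
Qed.

(** If [B] is a proper segment, let [c] be the least point beyond it: [(n + 1, c)] is a limit
    because [B] has no last element. Otherwise [Gam] itself has no last element, and the start of
    block [n + 1] is a limit. *)
Lemma limit_above : ge_omega_omega X Gam ->
  forall u, dom L u -> exists v, limit v /\ related L u v.
Proof.
have [[_ Gwf] Gtr Gtot] := Gam_wo.
move=> /ge_omega_segment[B [[xB [b0 Bb0] BD] [Bdown Bup]]] u.
move=> /dom_times_omega[n [a [-> hn ha]]].
have hSn : omega M (suc n) by apply: omegaS.
have nSn : n ∈ suc n by apply/mem_suc; right.
have [[y [Dy nBy]]|all_B] := pselect (exists y, dom Gam y /\ ~ B y).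
  have hC : X [set y | dom Gam y /\ ~ B y] by rewrite /dom; EC_solve.
  case: (Gwf _ hC); first by exists y.
  move=> c [[Dc nBc] cmin].
  have Bc b : B b -> related Gam b c.
    move=> Bb; case: (Gtot b c (BD b Bb) Dc) => [//|[bc|cb]].
      by case: nBc; rewrite -bc.
    by case: nBc; apply: Bdown cb.
  exists (pr (suc n) c); split.
    apply: limit_pair => // [|d dc]; first by exists b0; apply: Bc.
    have Bd : B d.
      by apply: contrapT => nBd; apply: (cmin d _ dc); split=> //; exists c; left.
    by have [e [Be de]] := Bup d Bd; exists e; split=> //; apply: Bc.
  by apply/times_omegaE; split=> //; left.
have DB y : dom Gam y -> B y.
  by move=> Dy; apply: contrapT => nBy; apply: all_B; exists y.
have hC : X (dom Gam) by rewrite /dom; EC_solve.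
case: (Gwf _ hC); first by exists a.
move=> c [Dc cmin]; exists (pr (suc n) c); split; last first.
  by apply/times_omegaE; split=> //; left.
split=> [|w wc]; first by apply/dom_times_omega; exists (suc n), c.
have [m [b [_ [_ [wE _]]]]] := times_omega_pairs wc.
move: wc; rewrite wE => /times_omegaE[hm _ Db _ [mn|[_ bc]]]; last first.
  by case: (cmin b Db bc).
have [b' [Bb' bb']] := Bup b (DB b Db); have Db' := BD _ Bb'.
by exists (pr m b'); split; apply/times_omegaE; split=> //; [right|left].
Qed.

End WellOrders.

(** * Recursion inside the hierarchy *)

Section Model.
Variables (M : structure) (X : set (set M)) (hX : GB X).
Let hZF : ZF M := GB_ZF hX.
Let hEC : ElementaryComprehension X := GB_comprehension hX.
Local Notation pr := (pr hZF).
Local Notation suc := (suc hZF).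
Local Notation tg := (tg hZF).
Local Notation zeroM := (zeroM hZF).

Variables (Gam A0 S : set M).
Local Notation L := (times_omega Gam).
Local Notation lev := (lev hX S).
Local Notation levels := (levels hX S).
Local Notation below := (below hX L S).

Hypotheses (xG : X Gam) (Gam_wo : class_well_order X Gam) (xS : X S).
Hypothesis hlim : forall u, dom L u ->
  exists v, limit Gam v /\ related L u v.
Hypothesis hS : hierarchy hX L A0 S.
Hypothesis A0_Gam : slice A0 (tg 0) = Gam.
Hypothesis Gam_n0 : dom Gam !=set0.

Let xL : X L := EC_times_omega hX hEC xG.
Let Ltr : forall u v w, related L u v -> related L v w -> related L u w :=
  times_omega_trans hX Gam_wo.

Lemma X_lev u j : X (lev u j).
Proof. by rewrite /lev; EC_solve. Qed.

Lemma X_below u : X (below u).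
Proof. by rewrite /below; EC_solve. Qed.

Lemma levels_limit_EC v u : limit Gam v -> related L u v ->
  ElementaryComprehension (levels [set w | related L w v]).
Proof.
move=> hv uv; apply: (levels_EC hS).
- by move=> w wv; exists v; left.
- by exists u.
- exact: (limit_dir hX xG Gam_wo hv).
Qed.

Lemma dom_times_omega_n0 : dom L !=set0.
Proof.
have [a ha] := Gam_n0; exists (pr zeroM a).
by apply/(dom_times_omega hX); exists zeroM, a; split=> //; apply: omega0.
Qed.

Lemma levels_dom_EC : ElementaryComprehension (levels (dom L)).
Proof.
apply: (levels_EC hS) => //; first exact: dom_times_omega_n0.
exact: (times_omega_dir hX xG Gam_wo).
Qed.

Lemma coded_below_lev u v j : related L u v ->
  coded_class hZF (below v) (pr u j) = lev u j.
Proof.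
by move=> uv; apply/predeqP => y; rewrite coded_below; split=> [[]|].
Qed.

Section Recursion.
Variables (phi : formula 2 1) (A R F : set M) (u0 m0 a0 : M).
Hypotheses (u0E : u0 = pr m0 a0) (hm0 : omega M m0) (ha0 : dom Gam a0).
Local Notation K v := (levels [set w | related L w v]).
Local Notation n0 := (suc m0).
Hypotheses (kA : K u0 A) (kR : K u0 R) (kF : K u0 F).
Hypothesis F_rank : is_rank_function F R Gam.
Local Notation solves_upto := (solves_upto hX phi Gam A R F).
Local Notation glue := (glue hX phi Gam A R F).

Let levX C I : levels I C -> X C.
Proof. by move=> [u [j [_ ->]]]; apply: X_lev. Qed.
Let xA : X A := levX kA.
Let xR : X R := levX kR.
Let xF : X F := levX kF.

Let F_mono r s d e :
  related R r s -> related F r d -> related F s e -> related Gam d e.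
Proof. by move=> rs rd se; have [h _] := F_rank.2 s e se; apply: h rd. Qed.

Let du0 : dom L u0.
Proof. by apply/(dom_times_omega hX); exists m0, a0. Qed.

(** Block [n0] lies wholly above the parameters, so the ranks [d] can be laid out along it. *)
Let u0_lt d : dom Gam d -> related L u0 (pr n0 d).
Proof.
move=> hd; rewrite u0E; apply/times_omegaE; split=> //.
- exact: omegaS.
- by left; apply/mem_suc; right.
Qed.

Let K_mono u v : related L u v -> K u `<=` K v.
Proof.
by move=> uv C [w [j [wu ->]]]; exists w, j; split=> //; apply: Ltr uv.
Qed.

Let K_glue v v' : limit Gam v -> related L u0 v -> related L v' v ->
  K v (glue (below v')).
Proof.
move=> hv u0v v'v; have KEC := levels_limit_EC hv v'v.
apply: EC_glue => //; [|exact: (K_mono u0v)..|].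
- by exists u0, (pr (tg 1) (tg 0)); split=> //; rewrite (lev_slice hS).
- exists v', (pr (tg 0) zeroM); split=> //; rewrite (lev_below hS) //.
  by exists v; left.
Qed.

(* The partial solution up to [d] appears below the next limit after
   [(n0, d)]: at a successor [d] finitely many further levels suffice, and at a
   limit [d] the earlier partial solutions are all coded in [below (n0, d)]. *)
Lemma partial_solution d v : dom Gam d -> limit Gam v ->
  related L (pr n0 d) v ->
  exists u j, related L u v /\ solves_upto (lev u j) d.
Proof.
move=> hd hv dv; apply: contrapT => nex.
have [_ Gtr Gtot] := Gam_wo.
(* The limit [v] is quantified inside the class of counterexamples, so that the induction hypothesis
   also applies to other limits, such as [(n0, d)]. *)
have hC : X [set d | dom Gam d /\ exists v, [/\ limit Gam v,
    related L (pr n0 d) v &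
    ~ exists u j, related L u v /\ solves_upto (lev u j) d]].
  rewrite /limit /dom /solves_upto /le_of /solves /stage /mkset.
  rewrite /lev /mkset; EC_solve.
  apply: dfn_sat21 => //; rewrite /restr /mkset; dfn_solve.
  by apply: (dfn_tc hX) => //; tdf_solve.
case: (wf_least Gam_wo hC); first by exists d; split=> //; exists v.
move=> {nex dv hv hd}{v}d [[hd [v [hv dv nex]]] dmin]; apply: nex.
have ih e w : related Gam e d -> limit Gam w -> related L (pr n0 e) w ->
    exists u j, related L u w /\ solves_upto (lev u j) e.
  move=> ed hw ew; apply: contrapT => nex; apply: (dmin e _ ed).
  by split; [exists d; left|exists w].
have n0e e : related Gam e d -> related L (pr n0 e) (pr n0 d).
  move=> ed; apply/times_omegaE; split=> //; try exact: omegaS; last by right.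
  by exists d; left.
have [v' [v'v hv']] : exists v', related L v' v /\ forall e, related Gam e d ->
    exists k, solves_upto (coded_class hZF (below v') k) e.
  (* If [d] has an immediate predecessor [c], the solution up to [c] covers all [e] below [d], and
     [v'] is any level between it and [v]. *)
  have [[c [cd cmax]]|nomax] := pselect (exists c, related Gam c d /\
      forall e, ~ (related Gam c e /\ related Gam e d)).
    have [u [j [uv hu]]] := ih c v cd hv (Ltr (n0e c cd) dv).
    have [v' [uv' v'v]] := hv.2 u uv; exists v'; split=> // e ed.
    exists (pr u j); rewrite coded_below_lev //.
    apply: (solves_upto_le Gam_wo hu).
    have [ec|[->|ce]] : related Gam e c \/ e = c \/ related Gam c e.
    + by apply: Gtot; [exists d; left|exists d; left].
    + by right.
    + by left.
    + by case: (cmax e).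
  (* Now [d] is least, and there is no [e], or [(n0, d)] is a limit, below which every earlier
     partial solution occurs. *)
  exists (pr n0 d); split=> // e ed.
  have hl : limit Gam (pr n0 d).
    apply: (limit_pair hX) => //; first exact: omegaS.
    - by exists e.
    - move=> a ad; apply: contrapT => na; apply: nomax; exists a; split=> // b hb.
      by apply: na; exists b.
  have [u [j [uv hu]]] := ih e _ ed hl (n0e e ed).
  by exists (pr u j); rewrite coded_below_lev.
have u0v : related L u0 v by apply: Ltr dv; apply: u0_lt.
have KEC := levels_limit_EC hv v'v.
have [u [j [uv hj]]] : K v (next_class hX phi A R (glue (below v'))).
  by apply: EC_next => //; [exact: (K_mono u0v)..|exact: K_glue].
exists u, j; split=> //; rewrite -hj.
apply: (next_glue_solves xG xF Gam_wo F_rank.1 F_mono) => //.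
exact: X_below.
Qed.

(** The limit [v] lies above the whole block [n0], so the partial solutions of all ranks are coded
    in [below v]. Their union is the full solution, and it occurs below the next limit [v']. *)
Lemma levels_recursion : exists P : set M,
  [/\ levels (dom L) P,
      forall p, P p -> exists r x, is_pair p r x /\ dom R r &
      forall r, dom R r -> slice P r = stage phi A R P r].
Proof.
have hSn0 : omega M (suc n0) by do !apply: omegaS.
have [v [hv wv]] : exists v, limit Gam v /\ related L (pr (suc n0) a0) v.
  by apply: hlim; apply/(dom_times_omega hX); exists (suc n0), a0.
have dv d : dom Gam d -> related L (pr n0 d) v.
  move=> hd; apply: Ltr wv; apply/times_omegaE; split=> //.
    exact: omegaS.
  by left; apply/mem_suc; right.
have [v' [hv' vv']] := hlim hv.1.
have u0v' : related L u0 v' by apply: Ltr vv'; apply: Ltr (dv _ ha0); apply: u0_lt.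
exists (glue (below v)); split.
- have [u [j [uv' ->]]] := K_glue hv' u0v' vv'.
  by exists u, j; split=> //; exists v'; left.
- move=> p [r [x [d [k [-> rd _ _]]]]]; exists r, x; split; first exact/is_pairE.
  move: rd => [q [/(is_pairE hZF) -> /F_rank.1.1[r' [y [/(is_pairE hZF)]]]]].
  by move=> /pr_inj[-> _].
- move=> r hr; have [d [rd _]] := F_rank.1.2 r hr.
  apply/predeqP => x; rewrite (sliceE hZF).
  apply: (glue_solves xG xF Gam_wo F_rank.1 F_mono _ rd _ x).
    exact: X_below.
  have hd : dom Gam d.
    move: rd => [q [/(is_pairE hZF) -> /F_rank.1.1[r' [y [/(is_pairE hZF)]]]]].
    by move=> /pr_inj[_ ->].
  have [u [j [uv hu]]] := partial_solution hd hv (dv d hd).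
  by exists (pr u j); rewrite coded_below_lev.
Qed.

End Recursion.

Lemma levels_ETR : ETR (levels (dom L)) Gam.
Proof.
move=> phi A R [u1 [j1 [hu1 AE]]] [u2 [j2 [hu2 RE]]] _.
move=> [F [[u3 [j3 [hu3 FE]]] F_rank]].
have dir := times_omega_dir hX xG Gam_wo.
have [w [hw u1w u2w]] := dir _ _ hu1 hu2.
have [u0 [hu0 wu0 u3u0]] := dir _ _ hw hu3.
have /(dom_times_omega hX)[m0 [a0 [u0E hm0 ha0]]] := hu0.
apply: (levels_recursion phi u0E hm0 ha0 _ _ _ F_rank).
- by exists u1, j1; split=> //; apply: Ltr wu0.
- by exists u2, j2; split=> //; apply: Ltr wu0.
- by exists u3, j3.
Qed.

End Model.

(** * The coded submodel *)

Lemma restr_below (M : structure) (X : set (set M)) (hX : GB X) (L S : set M) u :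
  X L ->
  (forall x y z, related L x y -> related L y z -> related L x z) ->
  restr S L u = below hX L S u.
Proof.
move=> xL Ltr; apply/predeqP => p; split.
  move=> [Sp [v [x [/(is_pairE (GB_ZF hX)) pE vu]]]]; exists v, x; split=> //.
  exact/(tc_trans hX xL Ltr).
move=> [v [x [-> vu Sp]]]; split=> //; exists v, x.
by split; [exact/(is_pairE (GB_ZF hX))|exact/(tc_trans hX xL Ltr)].
Qed.

(** [G] is a class that [Y] is made to keep; a bijection witnessing Global Choice will be put
    there. *)
Lemma exists_coded_model (M : structure) (X : set (set M)) (Gam G : set M) :
  GB X -> X Gam -> class_well_order X Gam -> ge_omega_omega X Gam ->
  ETR X (times_omega Gam) -> X G ->
  exists Y : set (set M),
    [/\ Y `<=` X, coded X Y, Y Gam & Y G] /\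
    [/\ GB Y, ETR Y Gam & ~ ETR Y (times_omega Gam)].
Proof.
move=> hX xGam Gam_wo hge hETR xG.
pose hZF := GB_ZF hX; have hEC := GB_comprehension hX.
pose prM := pr hZF; pose tgM := tg hZF.
(* [ETR] takes one class parameter, so [Gam] and [G] are packed into one as slices. *)
pose A0 : set M := [set p |
  exists x, (p = prM (tgM 0) x /\ Gam x) \/ (p = prM (tgM 1) x /\ G x)].
have EC_A0 K : ElementaryComprehension K -> K Gam -> K G -> K A0.
  by move=> hK kGam kG; rewrite /A0 /prM /tgM; EC_solve.
have A0_Gam : slice A0 (tgM 0) = Gam.
  apply/predeqP => y; rewrite (sliceE hZF); split=> [|hy]; last by exists y; left.
  by move=> [x [[/pr_inj[_ ->]]//|[/pr_inj[/tg_inj]]]].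
have A0_G : slice A0 (tgM 1) = G.
  apply/predeqP => y; rewrite (sliceE hZF); split=> [|hy]; last by exists y; right.
  by move=> [x [[/pr_inj[/tg_inj]]//|[/pr_inj[_ ->]]]].
have xL := EC_times_omega hX hEC xGam.
have L_wo := times_omega_wo hX xGam Gam_wo.
have Ltr := times_omega_trans hX Gam_wo.
have [Lwf _ _] := L_wo.
have [phi hphi] := step_formula hZF.
have [S [xS S_dom S_eq]] := hETR phi A0 _ (EC_A0 X hEC xGam xG) xL Lwf
  (rank_le_refl hX hEC xL L_wo).
have hS : hierarchy hX (times_omega Gam) A0 S.
  move=> u p hu; rewrite -(sliceE hZF) S_eq // hphi /=.
  by rewrite (restr_below hX S u xL Ltr).
have hlim := limit_above hX xGam Gam_wo hge.
have Gam_n0 : dom Gam !=set0.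
  by have [B [[_ [b Bb] BD] _]] := ge_omega_segment hX hge; exists b; apply: BD.
have YEC := levels_dom_EC xGam Gam_wo hS Gam_n0.
have [u0 hu0] := dom_times_omega_n0 hX Gam_n0.
pose Y := levels hX S (dom (times_omega Gam)).
have YX : Y `<=` X by move=> _ [u [j [_ ->]]]; apply: X_lev.
have YGam : Y Gam.
  by exists u0, (prM (tgM 1) (tgM 0)); rewrite (lev_slice hS).
have YG : Y G by exists u0, (prM (tgM 1) (tgM 1)); rewrite (lev_slice hS).
have YL := EC_times_omega hX YEC YGam.
exists Y; split; split=> //.
- exists [set p | exists u j y, p = prM (prM u j) y /\ S (prM u (prM j y))].
  split; first by rewrite /prM; EC_solve.
  set C := [set p | _].
  have CE u j : slice C (prM u j) = lev hX S u j.
    apply/predeqP => y; rewrite (sliceE hZF).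
    split=> [[u' [j' [y' [/pr_inj[/pr_inj[-> ->] ->]]]]]//|h].
    by exists u, j, y.
  apply/predeqP => B; split=> [[u [j [hu ->]]]|[i _ <-]].
    by exists (prM u j).
  have [[u [j [-> hu]]]|ni] := pselect (exists u j, i = prM u j /\
      dom (times_omega Gam) u); first by rewrite CE; exists u, j.
  (* An index that names no level yields the empty class, which is in [Y] by comprehension. *)
  have -> : slice C i = set0; last by rewrite /set0; EC_solve.
  rewrite -subset0 => y /(sliceE hZF)[u [j [z [/pr_inj[iE _]]]]] /S_dom.
  move=> [u' [x [/(is_pairE hZF)/pr_inj[<- _] hu]]].
  by apply: ni; exists u, j.
- split=> //.
  (* Class Replacement concerns one class at a time, so it passes to subfamilies. *)
  by move=> F a /YX; apply: GB_replacement.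
- exact: (levels_ETR xGam Gam_wo xS hlim hS A0_Gam).
- move=> YETR; have YA0 := EC_A0 _ YEC YGam YG.
  have YLwf : well_founded_class Y (times_omega Gam).
    by split; [exact: Lwf.1|move=> D /YX; apply: Lwf.2].
  have [S' [YS' S'_dom S'_eq]] := YETR phi A0 _ YA0 YL YLwf
    (rank_le_refl hX YEC YL L_wo).
  have [F [xF [F_fun F_rank]]] := rank_le_refl hX hEC xL L_wo.
  have F_mono r s d e : related (times_omega Gam) r s -> related F r d ->
      related F s e -> related (times_omega Gam) d e.
    by move=> rs rd se; have [h _] := F_rank s e se; apply: h rd.
  (* Uniqueness is applied in [X], which contains both solutions, with all ranks as the segment. *)
  have xT : X [set: M] by rewrite /setT; EC_solve.
  have SS' r x : dom (times_omega Gam) r -> S (prM r x) <-> S' (prM r x).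
    move=> hr; have [d [rd _]] := F_fun.2 r hr.
    have rdom r' d' : related F r' d' -> dom (times_omega Gam) r'.
      move=> [q [/(is_pairE hZF) -> /F_fun.1[r1 [y [/(is_pairE hZF)]]]]].
      by move=> /pr_inj[-> _].
    apply: (@solution_uniq _ _ hX phi _ A0 _ _ xL xF L_wo F_fun F_mono _ _ _ xT
      xS (YX _ YS')) rd _ => // r' d' rd' _ z.
    + by rewrite -(sliceE hZF) S_eq //; apply: rdom rd'.
    + by rewrite -(sliceE hZF) S'_eq //; apply: rdom rd'.
  have {}SS' : S = S'.
    apply/predeqP => p; split=> hp.
      have [r [x [/(is_pairE hZF) pE hr]]] := S_dom p hp.
      by move: hp; rewrite pE => /(SS' r x hr).
    have [r [x [/(is_pairE hZF) pE hr]]] := S'_dom p hp.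
    by move: hp; rewrite pE => /(SS' r x hr).
  have YS : Y S by rewrite SS'.
  (* The diagonal class of the indices that are not in the class they code is elementary in [S], so
     it would have an index [(u, j)] itself. *)
  have [u [j [hu DE]]] : Y [set p | exists u j, p = prM u j /\
      ~ S (prM u (prM j p))] by rewrite /prM; EC_solve.
  have := congr1 (fun C : set M => C (prM u j)) DE; rewrite /lev /=.
  have [h e|h e] := pselect (S (prM u (prM j (prM u j)))).
    by move: (h); rewrite -[S _]e => -[u' [j' [/pr_inj[<- <-]]]].
  by apply: (h); rewrite -[S _]e; exists u, j.
Qed.

Theorem theorem5p9 (M : structure) (X : set (set M)) (Gamma : set M)
    (hGB : GB X) (hGamma : X Gamma) (hwo : class_well_order X Gamma)
    (hge : ge_omega_omega X Gamma) (hETR : ETR X (times_omega Gamma)) :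
  (exists Y : set (set M),
     [/\ Y `<=` X, coded X Y & Y Gamma] /\
     [/\ GB Y, ETR Y Gamma & ~ ETR Y (times_omega Gamma)]) /\
  (GlobalChoice X ->
   exists Y : set (set M),
     [/\ Y `<=` X, coded X Y & Y Gamma] /\
     [/\ GB Y, ETR Y Gamma, ~ ETR Y (times_omega Gamma) & GlobalChoice Y]).
Proof.
have model G : X G -> exists Y : set (set M),
    [/\ Y `<=` X, coded X Y, Y Gamma & Y G] /\
    [/\ GB Y, ETR Y Gamma & ~ ETR Y (times_omega Gamma)].
  exact: exists_coded_model.
split=> [|[F [hF F_fun F_onto]]].
  (* Without Global Choice there is nothing further to preserve, and [Gamma] fills the place of
     [G]. *)
  by have [Y [[? ? ? _] ?]] := model _ hGamma; exists Y.
have [Y [[? ? ? YF] [? ? ?]]] := model _ hF.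
by exists Y; split; split=> //; exists F.
Qed.
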